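(* Let $K$ be an (oriented) virtual knot. Then $$\mathcal{L}(K)=\sum_{c} w(c)\,\widetilde{L}_c-w(K)\,(F(K)\cup U)\in\mathcal{M}_2,$$ computed from any diagram of $K$, defines a virtual knot invariant. Here $F(K)$ is the shadow of $K$, $U$ is the unknot, the sum runs over all real crossing points $c$ of the diagram, $w(c)\in\{\pm1\}$ is the writhe (sign) of $c$, $w(K)=\sum_c w(c)$ is the writhe of the diagram, and $\widetilde{L}_c$ is the oriented 2-component flat virtual link obtained from $K$ by $1$-smoothing at $c$ and taking the shadow.
   Context: A virtual knot (link) diagram is a generic immersed circle (collection of circles) in the plane with finitely many transversal double points, each double point being marked either as a real crossing (with over/under information) or as a virtual crossing. The generalized Reidemeister moves are: the classical Reidemeister moves $\Omega_1,\Omega_2,\Omega_3$ on real crossings; the moves $\Omega_1',\Omega_2',\Omega_3'$, which have the same shapes but with all crossings virtual; and $\Omega_3^v$, a third-Reidemeister-type move in which an arc having only two virtual crossings is moved across one real crossing. A virtual knot (link) is an equivalence class of diagrams under these moves (and planar isotopy). A flat virtual knot (link) diagram is defined in the same way, with each real crossing replaced by a flat crossing (no over/under information). The flat generalized Reidemeister moves are obtained from the generalized Reidemeister moves $\Omega_1,\Omega_2,\Omega_3,\Omega_1',\Omega_2',\Omega_3',\Omega_3^v$ by replacing all real crossings with flat crossings. Flat virtual knots (links) are equivalence classes of flat virtual knot (link) diagrams under the flat generalized Reidemeister moves. The shadow $F(D)$ of a virtual diagram $D$ is the flat diagram (and the flat virtual knot or link it represents) obtained by replacing every real crossing with a flat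 crossing. $F(K)\cup U$ is the 2-component flat virtual link consisting of $F(K)$ and a disjoint crossingless circle. A real crossing $c$ of an oriented virtual knot diagram $K$ has two resolutions (replacing a neighbourhood of the crossing by two disjoint arcs). The $1$-smoothing is the one which does not preserve the number of components, i.e. the orientation-compatible one. It gives an oriented 2-component virtual link diagram $L_c$, and $\widetilde{L}_c=F(L_c)$, whose two components are unordered. $\mathcal{M}_2$ is the free $\mathbf{Z}$-module generated by the set of all oriented (unordered) 2-component flat virtual links. *)

(* Defs.v *)
From HB Require Import structures.
From mathcomp Require Import ssreflect ssrfun ssrbool eqtype ssrnat seq choice.
From mathcomp Require Import fintype bigop generic_quotient ssralg ssrint.
From mathcomp Require Import boolp.
From mathcomp.multinomials Require Import freeg.
From Stdlib Require Relation_Operators.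

Set Implicit Arguments.
Unset Strict Implicit.
Unset Printing Implicit Defensive.

(* Planar diagrams are in Morse position with respect to the height function:
   a diagram is read from bottom to top, and is cut by horizontal lines into
   slices, each of which holds one local minimum (Cup), one local maximum (Cap)
   or one double point (Cross).  The slice (p, i) is p with i vertical strands
   on its left (strands are numbered from 0), and with the remaining strands on
   its right.  The piece Cross joins position i below to position i.+1 above,
   and position i.+1 below to position i above.  Every generic immersed
   collection of circles in the plane is planar isotopic to one of this form. *)

(* L is the information carried by a real (or flat) crossing: bool in a virtual
   diagram, unit in a flat one.  In a virtual diagram, the boolean is true when
   the strand going from the lower left to the upper right is the over strand. *)
Inductive crossing (L : Type) := Real of L | Virtual.
Arguments Virtual {L}.

(* Cup o creates strands with orientations (o, ~~ o); an orientation is true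
   for a strand going up. *)
Inductive piece (L : Type) := Cup of bool | Cap | Cross of crossing L.
Arguments Cup {L}.
Arguments Cap {L}.

Definition slice (L : Type) : Type := (piece L * nat)%type.
Definition word (L : Type) : Type := seq (slice L).

Section PieceChoice.
Variable L : choiceType.

Definition piece_code (p : piece L) : bool + option (option L) :=
  match p with
  | Cup o => inl o
  | Cap => inr None
  | Cross Virtual => inr (Some None)
  | Cross (Real x) => inr (Some (Some x))
  end.

Definition piece_decode (c : bool + option (option L)) : piece L :=
  match c with
  | inl o => Cup o
  | inr None => Cap
  | inr (Some None) => Cross Virtual
  | inr (Some (Some x)) => Cross (Real x)
  end.

Lemma piece_codeK : cancel piece_code piece_decode.
Proof. by case=> [|| []]. Qed.

HB.instance Definition _ := Choice.copy (piece L) (can_type piece_codeK).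
End PieceChoice.

(* The orientations of the strands above a slice, given those below it; None
   when the slice does not fit. *)
Definition pass (L : Type) (s : seq bool) (e : slice L) : option (seq bool) :=
  let: (p, i) := e in
  match p with
  | Cup o =>
      if i <= size s then Some (take i s ++ [:: o; ~~ o] ++ drop i s) else None
  | Cap =>
      if drop i s is a :: b :: t then
        if a != b then Some (take i s ++ t) else None
      else None
  | Cross _ =>
      if drop i s is a :: b :: t then Some (take i s ++ [:: b; a] ++ t) else None
  end.

Fixpoint run (L : Type) (s : seq bool) (w : word L) : option (seq bool) :=
  if w is e :: w' then obind (fun s' => run s' w') (pass s e) else Some s.

(* Oriented link diagrams with any number of components. *)
Record diagram (L : Type) :=
  Diagram { word_of : word L; _ : run [::] word_of == Some [::] }.

HB.instance Definition _ (L : Type) := [isSub for @word_of L].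
HB.instance Definition _ (L : choiceType) := [Choice of diagram L by <:].

(* The number of circles closed up by w above strands carrying the labels s;
   two strands carry the same label when they are already connected below, and
   the labels from n on are fresh. *)
Fixpoint closed_circles (L : Type) (n : nat) (s : seq nat) (w : word L) : nat :=
  match w with
  | [::] => 0
  | (Cup _, i) :: w' =>
      closed_circles n.+1 (take i s ++ [:: n; n] ++ drop i s) w'
  | (Cap, i) :: w' =>
      let a := nth 0 s i in
      let b := nth 0 s i.+1 in
      (a == b) + closed_circles n
        [seq if c == b then a else c | c <- take i s ++ drop i.+2 s] w'
  | (Cross _, i) :: w' =>
      closed_circles n
        (take i s ++ [:: nth 0 s i.+1; nth 0 s i] ++ drop i.+2 s) w'
  end.

Definition ncomponents (L : Type) (D : diagram L) : nat :=
  closed_circles 0 [::] (word_of D).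

Definition width_in (L : Type) (p : piece L) := if p is Cup _ then 0 else 2.
Definition width_out (L : Type) (p : piece L) := if p is Cap then 0 else 2.

(* The crossing seen after rotating the plane by a quarter turn. *)
Definition quarter_turn (x : crossing bool) : crossing bool :=
  if x is Real b then Real (~~ b) else Virtual.

(* The moves generating planar isotopy of diagrams in Morse position: changing
   the relative height of two distant slices, cancelling a minimum against an
   adjacent maximum, and moving a crossing past an extremum. *)
Inductive planar_move : word bool -> word bool -> Prop :=
| Exchange p q i k :
    planar_move [:: (p, i); (q, i + k + width_out p)]
                [:: (q, i + k + width_in p); (p, i)]
| Zigzag_left o i :
    planar_move [:: (Cup o, i); (Cap, i.+1)] [::]
| Zigzag_right o i :
    planar_move [:: (Cup o, i.+1); (Cap, i)] [::]
| Cup_slide o x i :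
    planar_move [:: (Cup o, i); (Cross x, i.+1)]
                [:: (Cup o, i.+1); (Cross (quarter_turn x), i)]
| Cap_slide x i :
    planar_move [:: (Cross x, i.+1); (Cap, i)]
                [:: (Cross (quarter_turn x), i); (Cap, i.+1)].

(* In a third move the strands are A, B, C from left to right below the
   triangle; the crossings met from bottom to top are AB, AC, BC on one side
   and BC, AC, AB on the other.  The boolean of each crossing tells whether the
   first of its two strands is over; Omega3 requires one of the six consistent
   height orders of A, B, C and excludes the two cyclic patterns. *)
Definition layered (ab ac bc : bool) : bool := (ab == bc) ==> (ac == ab).

Definition triangle_below (ab ac bc : crossing bool) (i : nat) : word bool :=
  [:: (Cross ab, i); (Cross ac, i.+1); (Cross bc, i)].
Definition triangle_above (ab ac bc : crossing bool) (i : nat) : word bool :=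
  [:: (Cross bc, i.+1); (Cross ac, i); (Cross ab, i.+1)].

(* Up to planar isotopy every instance of a move has one of these forms.  The
   two forms of the first move have loops of opposite rotation. *)
Inductive reidemeister_move : word bool -> word bool -> Prop :=
| Omega1_right o x i :
    reidemeister_move
      [:: (Cup o, i.+1); (Cross (Real x), i); (Cap, i.+1)] [::]
| Omega1_left o x i :
    reidemeister_move
      [:: (Cup o, i); (Cross (Real x), i.+1); (Cap, i)] [::]
| Omega2 x i :
    reidemeister_move [:: (Cross (Real x), i); (Cross (Real (~~ x)), i)] [::]
| Omega3 x y z i :
    layered x y z ->
    reidemeister_move (triangle_below (Real x) (Real y) (Real z) i)
                      (triangle_above (Real x) (Real y) (Real z) i)
| Omega1'_right o i :
    reidemeister_move
      [:: (Cup o, i.+1); (Cross Virtual, i); (Cap, i.+1)] [::]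
| Omega1'_left o i :
    reidemeister_move
      [:: (Cup o, i); (Cross Virtual, i.+1); (Cap, i)] [::]
| Omega2' i :
    reidemeister_move [:: (Cross Virtual, i); (Cross Virtual, i)] [::]
| Omega3' i :
    reidemeister_move (triangle_below Virtual Virtual Virtual i)
                      (triangle_above Virtual Virtual Virtual i)
| Omega3v_A x i :
    reidemeister_move (triangle_below Virtual Virtual (Real x) i)
                      (triangle_above Virtual Virtual (Real x) i)
| Omega3v_B x i :
    reidemeister_move (triangle_below Virtual (Real x) Virtual i)
                      (triangle_above Virtual (Real x) Virtual i)
| Omega3v_C x i :
    reidemeister_move (triangle_below (Real x) Virtual Virtual i)
                      (triangle_above (Real x) Virtual Virtual i).

(* The moves carry orientations only through Cup; the orientations on the two
   sides agree because both D and D' are diagrams. *)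
Definition virtual_step (D D' : diagram bool) : Prop :=
  exists u l r v : word bool,
    [/\ word_of D = u ++ l ++ v, word_of D' = u ++ r ++ v
      & planar_move l r \/ reidemeister_move l r].

Definition shadow_slice (e : slice bool) : slice unit :=
  (match e.1 with
   | Cup o => Cup o
   | Cap => Cap
   | Cross (Real _) => Cross (Real tt)
   | Cross Virtual => Cross Virtual
   end, e.2).

Lemma pass_shadow s (e : slice bool) : pass s (shadow_slice e) = pass s e.
Proof. by case: e => -[o||[x|]] i. Qed.

Lemma run_cons (L : Type) s (e : slice L) (w : word L) :
  run s (e :: w) = obind (fun s' => run s' w) (pass s e).
Proof. by []. Qed.

Lemma run_shadow s (w : word bool) : run s (map shadow_slice w) = run s w.
Proof.
elim: w s => [|e w IHw] s //.
by rewrite map_cons !run_cons pass_shadow; case: (pass s e) => [s'|] /=.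
Qed.

Lemma shadow_subproof (D : diagram bool) :
  run [::] (map shadow_slice (word_of D)) == Some [::].
Proof. by rewrite run_shadow; case: D. Qed.

Definition shadow (D : diagram bool) : diagram unit :=
  Diagram (shadow_subproof D).

(* The flat moves are the shadows of the virtual ones. *)
Definition flat_step (E E' : diagram unit) : Prop :=
  exists D D' : diagram bool,
    [/\ shadow D = E, shadow D' = E' & virtual_step D D'].

Definition generated (T : Type) (R : T -> T -> Prop) : rel T :=
  fun x y => `[< Relation_Operators.clos_refl_sym_trans T R x y >].

Section GeneratedEquivalence.
Variables (T : Type) (R : T -> T -> Prop).

Lemma generated_refl : reflexive (generated R).
Proof. by move=> x; apply/asboolP/Relation_Operators.rst_refl. Qed.

Lemma generated_sym : symmetric (generated R).
Proof. by move=> x y; apply/asboolP/asboolP; apply: Relation_Operators.rst_sym. Qed.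

Lemma generated_trans : transitive (generated R).
Proof.
move=> y x z /asboolP xy /asboolP yz.
by apply/asboolP; apply: Relation_Operators.rst_trans xy yz.
Qed.

Canonical generated_equiv :=
  EquivRel (generated R) generated_refl generated_sym generated_trans.
End GeneratedEquivalence.

Definition knot_diagram := {D : diagram bool | ncomponents D == 1}.

Definition knot_equiv : rel knot_diagram :=
  fun D D' => generated virtual_step (val D) (val D').

Lemma knot_equiv_refl : reflexive knot_equiv.
Proof. by move=> D; apply: generated_refl. Qed.

Lemma knot_equiv_sym : symmetric knot_equiv.
Proof. by move=> D D'; apply: generated_sym. Qed.

Lemma knot_equiv_trans : transitive knot_equiv.
Proof. by move=> D' D D''; apply: generated_trans. Qed.

Canonical knot_equivalence :=
  EquivRel knot_equiv knot_equiv_refl knot_equiv_sym knot_equiv_trans.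

Definition virtual_knot := {eq_quot knot_equiv}%qT.
HB.instance Definition _ := Choice.on virtual_knot.
Definition knot_of (D : knot_diagram) : virtual_knot := (\pi_virtual_knot D)%qT.

Definition flat_link := {eq_quot (generated flat_step)}%qT.
HB.instance Definition _ := Choice.on flat_link.
Definition flat_link_of (E : diagram unit) : flat_link := (\pi_flat_link E)%qT.

(* Two components, without any ordering of the two. *)
Definition two_components (l : flat_link) : bool :=
  `[< exists2 E, flat_link_of E = l & ncomponents E = 2 >].

Definition flat_link2 := {l : flat_link | two_components l}.

Import GRing.Theory.
Local Open Scope ring_scope.

(* M2 is the free Z-module M_2.  It is a submodule of the free Z-module M on
   all flat virtual links, through the injection M2_in_M induced by the
   inclusion of flat_link2 in flat_link. *)
Definition M := {freeg flat_link / int}.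
Definition M2 := {freeg flat_link2 / int}.
Definition M2_in_M (m : M2) : M :=
  fglift (fun l : flat_link2 => << val l >> : M) m.

(* Crossings are designated by their index in the word. *)
Definition is_real (w : word bool) (c : nat) : bool :=
  if nth (Cap, 0%N) w c is (Cross (Real _), _) then true else false.

(* The orientations of the two strands entering slice c from below. *)
Definition strands_at (w : word bool) (c : nat) : bool * bool :=
  let s := odflt [::] (run [::] (take c w)) in
  let i := (nth (Cap, 0%N) w c).2 in
  (nth true s i, nth true s i.+1).

(* With both strands going up (or both down), a crossing is positive when the
   strand from lower left to upper right is over; reversing exactly one strand
   changes the sign. *)
Definition sign (w : word bool) (c : nat) : int :=
  if nth (Cap, 0%N) w c is (Cross (Real x), _) then
    let: (a, b) := strands_at w c in
    if x (+) (a != b) then 1 else -1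
  else 0.

(* Parallel strands are separated vertically, which deletes the slice;
   antiparallel ones are separated by a maximum below a minimum. *)
Definition smooth_word (w : word bool) (c : nat) : word bool :=
  if nth (Cap, 0%N) w c is (Cross (Real _), i) then
    let: (a, b) := strands_at w c in
    take c w ++ (if a == b then [::] else [:: (Cap, i); (Cup b, i)])
      ++ drop c.+1 w
  else w.

Lemma run_cat (L : Type) s (w1 w2 : word L) :
  run s (w1 ++ w2) = obind (fun s' => run s' w2) (run s w1).
Proof. by elim: w1 s => //= e w1 IHw s; case: pass. Qed.

Lemma smooth_subproof (D : diagram bool) (c : nat) :
  run [::] (smooth_word (word_of D) c) == Some [::].
Proof.
case: D => w /= wP; rewrite /smooth_word /strands_at.
case E: nth => [[o||[x|]] i] //=.
have ltcw : (c < size w)%N.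
  by rewrite ltnNge; apply/negP => le_wc; rewrite nth_default in E.
move: wP; rewrite -{1}(cat_take_drop c w) (drop_nth (Cap, 0%N) ltcw) E.
rewrite !run_cat /=; case: run => //= s.
case Es: (drop i s) => [|a [|b t]] //=.
have [ea eb] : nth true s i = a /\ nth true s i.+1 = b.
  by rewrite -[i in nth true s i]addn0 -addn1 -!nth_drop Es.
have sz_i : size (take i s) = i.
  rewrite size_takel // ltnW //; move: (congr1 size Es).
  by rewrite size_drop -subn_gt0 => ->.
rewrite ea eb run_cat; case: (eqVneq a b) => [eq_ab | neq_ab].
  by rewrite -[X in run X [::]](cat_take_drop i s) Es eq_ab.
rewrite /= Es neq_ab /= size_cat sz_i leq_addr.
rewrite (take_size_cat _ sz_i) (drop_size_cat _ sz_i) /=.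
by have -> : ~~ b = a by case: a b neq_ab {ea eb Es} => [] [].
Qed.

(* The 1-smoothing L_c of D at the real crossing c. *)
Definition smooth (D : diagram bool) (c : nat) : diagram bool :=
  Diagram (smooth_subproof D c).

(* Disjoint union with a crossingless circle.  The circle with the other
   orientation represents the same flat link, by two first moves. *)
Lemma add_circle_subproof (E : diagram unit) :
  run [::] (word_of E ++ [:: (Cup true, 0%N); (Cap, 0%N)]) == Some [::].
Proof. by case: E => w /= /eqP wP; rewrite run_cat wP. Qed.

Definition add_circle (E : diagram unit) : diagram unit :=
  Diagram (add_circle_subproof E).

Definition writhe (D : diagram bool) : int :=
  \sum_(c < size (word_of D) | is_real (word_of D) c) sign (word_of D) c.

Definition calL (D : diagram bool) : M :=
  \sum_(c < size (word_of D) | is_real (word_of D) c)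
     sign (word_of D) c *: (<< flat_link_of (shadow (smooth D c)) >> : M)
  - writhe D *: (<< flat_link_of (add_circle (shadow D)) >> : M).

(* Main.v *)
(* Invariance.  Smoothing commutes with a move performed away from the smoothed
   crossing, so the terms of the crossings outside the moved part agree on the
   two sides.  For the crossings inside it, all smoothings are compared in the
   flat world, where a crossing can be slid past an extremum, cancelled against
   itself, or absorbed by an adjacent extremum.  The crossing of a first move
   contributes its sign times F(K) u U, which the writhe term cancels; the two
   crossings of a second move have opposite signs and the same flat smoothing;
   a third move pairs the three crossings on both sides, and any two paired
   smoothings have the same flat class.

   Two components.  The strands crossing a horizontal line are paired by the
   arcs below it, an upward strand with a downward one.  Smoothing a crossing
   exchanges the partners of two strands with the same orientation, and this
   exchange changes the number of circles closed above the line by exactly one.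
   The smoothing of a knot still contains a circle, hence it has two. *)

From mathcomp Require Import ssreflect ssrfun ssrbool eqtype ssrnat seq choice.
From mathcomp Require Import fintype bigop generic_quotient ssralg ssrint.
From mathcomp Require Import boolp.
From mathcomp.multinomials Require Import freeg.
From Stdlib Require Relation_Operators.
Require Import Defs.

Set Implicit Arguments.
Unset Strict Implicit.
Unset Printing Implicit Defensive.
Import GRing.Theory.

(** * Moves and flat classes *)

(** Adding [k] strands on the left of a picture. Local facts are proved at the far left and
    transported to every position by raising. *)
Definition raise (L : Type) (k : nat) (w : word L) : word L :=
  [seq (e.1, e.2 + k) | e <- w].

Lemma pass_raise (L : Type) s1 s (e : slice L) :
  pass (s1 ++ s) (e.1, e.2 + size s1) = omap (cat s1) (pass s e).
Proof.
have take_s j : take (j + size s1) (s1 ++ s) = s1 ++ take j s.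
  by rewrite take_cat ltnNge leq_addl /= addnK.
have drop_s j : drop (j + size s1) (s1 ++ s) = drop j s.
  by rewrite drop_cat ltnNge leq_addl /= addnK.
case: e => -[o||x] j /=; rewrite take_s drop_s.
- by rewrite size_cat addnC leq_add2l; case: ifP; rewrite //= -catA.
- by case: drop => [|a [|b t]] //=; case: ifP; rewrite //= catA.
- by case: drop => [|a [|b t]] //=; rewrite catA.
Qed.

Lemma run_raise (L : Type) s1 s (w : word L) :
  run (s1 ++ s) (raise (size s1) w) = omap (cat s1) (run s w).
Proof.
elim: w s => [|e w IHw] s //.
rewrite [raise _ _]/= !run_cons pass_raise; case: (pass s e) => //=.
Qed.

Lemma pass_raise_out (L : Type) s k (e : slice L) :
  size s < k -> pass s (e.1, e.2 + k) = None.
Proof.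
move=> lt_sk; have le_s j : size s <= j + k.
  by rewrite (leq_trans (ltnW lt_sk)) ?leq_addl.
case: e => -[o||x] j /=; rewrite ?drop_oversize //.
by rewrite leqNgt (leq_trans lt_sk) ?leq_addl.
Qed.

(** Only one inclusion is asked: the empty right side of a zigzag, kink or bigon accepts any
    strands, while its left side needs enough strands, suitably oriented. *)
Definition run_sub (L : Type) (l r : word L) : Prop :=
  forall s t, run s l = Some t -> run s r = Some t.

(** An empty [l] would run below fewer than [k] strands, where the raised [r] may fail; a nonempty
    one fails there as well. *)
Lemma run_sub_raise (L : Type) k (l r : word L) :
  l <> [::] -> run_sub l r -> run_sub (raise k l) (raise k r).
Proof.
move=> l_neq0 sub_lr s t.
case: (leqP k (size s)) => [le_ks | lt_sk].
  rewrite -(cat_take_drop k s); move: (take k s) (size_takel le_ks) => s1 <-.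
  rewrite !run_raise.
  by case E: run => [t'|] //=; rewrite (sub_lr _ _ E).
by case: l l_neq0 {sub_lr} => // e l _; rewrite [raise _ _]/= run_cons pass_raise_out.
Qed.

Definition move (l r : word bool) := planar_move l r \/ reidemeister_move l r.

Lemma move_raise k l r : move l r -> move (raise k l) (raise k r).
Proof.
case=> [[p q i j|o i|o i|o x i|x i]|[]]; last 11 first.
all: try by move=> *; right; constructor.
all: left; try by constructor.
have E n : i + j + n + k = i + k + j + n by rewrite addnAC (addnAC i).
by rewrite /raise /= !E; constructor.
Qed.

(** The two pieces act on disjoint groups of strands. Having an equality, and not just an inclusion,
    makes the exchange usable in both directions. *)
Lemma exchange_run (L : Type) (p q : piece L) k :
  (@run L)^~ [:: (p, 0); (q, k + width_out p)] =1
  (@run L)^~ [:: (q, k + width_in p); (p, 0)].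
Proof.
have passE s1 s : pass (s1 ++ s) (q, k + size s1) = omap (cat s1) (pass s (q, k)).
  exact: (pass_raise s1 s (q, k)).
have run1 s e : run s [:: e] = pass (L := L) s e by rewrite /=; case: pass.
have run2 s s' e1 e2 : pass s e1 = Some s' -> run s [:: e1; e2] = pass (L := L) s' e2.
  by rewrite run_cons => ->; apply: run1.
have passE2 a b s : pass (a :: b :: s) (q, k + 2) = omap (cat [:: a; b]) (pass s (q, k)).
  exact: (passE [:: a; b]).
have short s p' : size s < 2 -> run s [:: (q, k + 2); p'] = None.
  by move=> lt_s2; rewrite run_cons (pass_raise_out (q, k) lt_s2).
case: p => [o||x].
- move=> s; rewrite /width_out /width_in addn0.
  have/run2-> : pass (L := L) s (Cup o, 0) = Some (o :: ~~ o :: s) by rewrite /= ?take0 ?drop0.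
  rewrite passE2 run_cons; case: (pass s (q, k)) => //= s'.
  by rewrite ?take0 ?drop0.
- have run_cap a b s' : run (a :: b :: s') [:: (Cap, 0); (q, k)] =
      if a != b then pass s' (q, k) else None.
    rewrite run_cons; have -> : pass (a :: b :: s') (Cap, 0) =
      if a != b then Some s' else None :> option (seq bool) by rewrite /= ?drop0.
    by case: ifP => // _; apply: run1.
  rewrite /width_out /width_in addn0.
  case=> [|a [|b s]]; [by rewrite short | by rewrite short |].
  rewrite run_cap run_cons passE2.
  move: (pass s (q, k)) => r.
  by case: ifP => ab; case: r => //= s'; rewrite ab ?drop0 ?take0.
- rewrite /width_out /width_in; case=> [|a [|b s]]; [by rewrite short | by rewrite short |].
  have/run2-> : pass (a :: b :: s) (Cross x, 0) = Some (b :: a :: s) by [].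
  by rewrite run_cons !passE2; case: (pass s (q, k)).
Qed.

Lemma planar_move_run_sub l r : planar_move l r -> run_sub l r.
Proof.
case=> [p q i j|o i|o i|o x i|x i].
- rewrite -!addnA ![i + _]addnC.
  apply: (@run_sub_raise _ i [:: (p, 0); (q, j + width_out p)]
            [:: (q, j + width_in p); (p, 0)]) => //.
  by move=> s t; rewrite exchange_run.
- apply: (@run_sub_raise _ i [:: (Cup o, 0); (Cap, 1)] [::]) => //.
  case=> [|a s] t //=; rewrite ?take0 ?drop0 /=; case: ifP => //=.
  by case: o a => -[].
- apply: (@run_sub_raise _ i [:: (Cup o, 1); (Cap, 0)] [::]) => //.
  case=> [|a s] t //=; rewrite ?take0 ?drop0 /=; case: ifP => //=.
  by case: o a => -[].
- apply: (@run_sub_raise _ i [:: (Cup o, 0); (Cross x, 1)]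
            [:: (Cup o, 1); (Cross (quarter_turn x), 0)]) => //.
  by case=> [|a s] t //=; rewrite ?take0 ?drop0.
- apply: (@run_sub_raise _ i [:: (Cross x, 1); (Cap, 0)]
            [:: (Cross (quarter_turn x), 0); (Cap, 1)]) => //.
  by case=> [|a [|b [|c s]]] t.
Qed.

Lemma reidemeister_move_run_sub l r : reidemeister_move l r -> run_sub l r.
Proof.
have kink_right o x : run_sub (L := bool) [:: (Cup o, 1); (Cross x, 0); (Cap, 1)] [::].
  case=> [|a s] t //=; rewrite ?take0 ?drop0 /=; case: ifP => //=.
  by case: o a => -[].
have kink_left o x : run_sub (L := bool) [:: (Cup o, 0); (Cross x, 1); (Cap, 0)] [::].
  case=> [|a s] t //=; rewrite ?take0 ?drop0 /=; case: ifP => //=.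
  by case: o a => -[].
have bigon x y : run_sub (L := bool) [:: (Cross x, 0); (Cross y, 0)] [::].
  by case=> [|a [|b s]].
have triangle x y z :
    run_sub (triangle_below x y z 0) (triangle_above x y z 0).
  by case=> [|a [|b [|c s]]].
case=> [o x i|o x i|x i|x y z i _|o i|o i|i|i|x i|x i|x i].
- exact: (@run_sub_raise _ i _ [::] _ (kink_right o (Real x))).
- exact: (@run_sub_raise _ i _ [::] _ (kink_left o (Real x))).
- exact: (@run_sub_raise _ i _ [::] _ (bigon (Real x) (Real (~~ x)))).
- exact: (@run_sub_raise _ i _ _ _ (triangle (Real x) (Real y) (Real z))).
- exact: (@run_sub_raise _ i _ [::] _ (kink_right o Virtual)).
- exact: (@run_sub_raise _ i _ [::] _ (kink_left o Virtual)).
- exact: (@run_sub_raise _ i _ [::] _ (bigon Virtual Virtual)).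
all: exact: (@run_sub_raise _ i _ _ _ (triangle _ _ _)).
Qed.

Lemma move_run_sub l r : move l r -> run_sub l r.
Proof.
by case=> [/planar_move_run_sub | /reidemeister_move_run_sub].
Qed.

(** * Flat classes of words, compared inside a context *)

(** Being partial, it applies to bare words: [None] marks those that do not close up to a
    diagram. *)
Definition flat_class (w : word bool) : option flat_link :=
  omap (fun D => flat_link_of (shadow D)) (insub w : option (diagram bool)).

Lemma flat_class_word (D : diagram bool) :
  flat_class (word_of D) = Some (flat_link_of (shadow D)).
Proof. by rewrite /flat_class (valK D). Qed.

Lemma flat_class_shadow w w' :
  map shadow_slice w = map shadow_slice w' -> flat_class w = flat_class w'.
Proof.
move=> eq_ww'; have eq_run : run [::] w = run [::] w'.
  by rewrite -run_shadow eq_ww' run_shadow.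
rewrite /flat_class; case: (boolP (run [::] w == Some [::])) => wP.
  have w'P : run [::] w' == Some [::] by rewrite -eq_run.
  rewrite (insubT (fun w => run [::] w == Some [::]) wP)
    (insubT (fun w => run [::] w == Some [::]) w'P) /=.
  by congr (Some (flat_link_of _)); apply: val_inj.
by rewrite !insubN // -eq_run.
Qed.

Lemma flat_class_move u l r v :
    move l r -> run [::] (u ++ l ++ v) = Some [::] ->
    run [::] (u ++ r ++ v) = Some [::] ->
  flat_class (u ++ l ++ v) = flat_class (u ++ r ++ v).
Proof.
move=> mlr /eqP lP /eqP rP.
rewrite (flat_class_word (Diagram lP)) (flat_class_word (Diagram rP)).
congr Some; apply/eqmodP/asboolP/Relation_Operators.rst_step.
exists (Diagram lP), (Diagram rP); split=> //.
by exists u, l, r, v.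
Qed.

(* The words are compared with any further strands s1 on their left. *)
Definition flat_at (s : seq bool) (l r : word bool) : Prop :=
  forall t, run s l = Some t ->
    run s r = Some t /\
    forall s1 u v, run [::] u = Some (s1 ++ s) -> run (s1 ++ t) v = Some [::] ->
      flat_class (u ++ raise (size s1) l ++ v) =
      flat_class (u ++ raise (size s1) r ++ v).

Definition flat_sub (l r : word bool) : Prop := forall s, flat_at s l r.

Lemma flat_sub_move l r : move l r -> flat_sub l r.
Proof.
move=> mlr s t run_l; have run_r := move_run_sub mlr run_l.
split=> // s1 u v run_u run_v; apply: flat_class_move; first exact: move_raise.
  by rewrite run_cat run_u /= run_cat run_raise run_l.
by rewrite run_cat run_u /= run_cat run_raise run_r.
Qed.

Lemma flat_at_trans s m l r : flat_at s l m -> flat_at s m r -> flat_at s l r.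
Proof.
move=> lm mr t /lm[/mr[run_r eq_mr] eq_lm]; split=> // s1 u v run_u run_v.
by rewrite eq_lm // eq_mr.
Qed.

Lemma flat_sub_trans m l r : flat_sub l m -> flat_sub m r -> flat_sub l r.
Proof. by move=> lm mr s; apply: flat_at_trans (lm s) (mr s). Qed.

(** Equality of classes is symmetric, so only the missing inclusion of runs has to be supplied. *)
Lemma flat_at_rev s l r :
  flat_at s l r -> (forall t, run s r = Some t -> run s l = Some t) -> flat_at s r l.
Proof.
move=> lr rl t /rl run_l; have [_ eq_lr] := lr _ run_l.
by split=> // s1 u v run_u run_v; rewrite eq_lr.
Qed.

Lemma flat_sub_rev l r : flat_sub l r -> run_sub r l -> flat_sub r l.
Proof. by move=> lr rl s; apply: flat_at_rev (lr s) (rl s). Qed.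

(** The inner context [u], [v] is absorbed into the outer one over which [flat_at] quantifies. *)
Lemma flat_sub_ctx u v l r : flat_sub l r -> flat_sub (u ++ l ++ v) (u ++ r ++ v).
Proof.
move=> lr s t; rewrite !run_cat; case run_u: (run s u) => [s'|] //=.
rewrite !run_cat; case run_l: (run s' l) => [t'|] //= run_v.
have [run_r eq_lr] := lr _ _ run_l; rewrite run_r; split=> // s1 u1 v1 run_u1 run_v1.
rewrite /raise !map_cat -!catA -!/(raise _ _) !(catA u1); apply: eq_lr.
  by rewrite run_cat run_u1 /= run_raise run_u.
by rewrite run_cat run_raise run_v.
Qed.

Arguments flat_sub_ctx u v {l r} _.

(** This is how over and under are switched freely in the comparisons below. *)
Lemma flat_sub_shadow l r :
  map shadow_slice l = map shadow_slice r -> flat_sub l r.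
Proof.
move=> eq_lr s t run_l; split; first by rewrite -run_shadow -eq_lr run_shadow.
move=> s1 u v _ _; apply: flat_class_shadow; rewrite !map_cat; congr (_ ++ (_ ++ _)).
have raise_shadow k w : map shadow_slice (raise k w) = raise k (map shadow_slice w).
  by rewrite /raise -!map_comp; apply: eq_map => -[[o||[x|]] i].
by rewrite !raise_shadow eq_lr.
Qed.

Lemma flat_sub_refl l : flat_sub l l.
Proof. exact: flat_sub_shadow. Qed.

(** The extra strands [s1] in [flat_at] serve here: raising by [size s0] merely turns them into
    [s1 ++ s0]. *)
Lemma flat_at_raise s0 s l r :
  flat_at s l r -> flat_at (s0 ++ s) (raise (size s0) l) (raise (size s0) r).
Proof.
move=> lr t; rewrite !run_raise; case run_l: run => [t'|] //= [<-].
have [-> eq_lr] := lr _ run_l; split=> // s1 u v run_u run_v.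
have raiseD w : raise (size s1) (raise (size s0) w) = raise (size (s1 ++ s0)) w.
  rewrite /raise -map_comp; apply: eq_map => -[p i] /=.
  by rewrite size_cat -addnA [size s0 + _]addnC.
by rewrite !raiseD; apply: eq_lr; rewrite -catA.
Qed.

Lemma flat_sub_raise k l r :
  l <> [::] -> flat_sub l r -> flat_sub (raise k l) (raise k r).
Proof.
move=> l_neq0 lr s; case: (leqP k (size s)) => [le_ks | lt_sk]; last first.
  by case: l l_neq0 {lr} => // e l _ t; rewrite [raise _ _]/= run_cons pass_raise_out.
rewrite -(cat_take_drop k s); move: (take k s) (size_takel le_ks) => s0 <-.
exact: flat_at_raise.
Qed.

(* flat_sub unfolds to a product, from which Set Implicit Arguments would infer
   every argument of the following lemmas. *)
Unset Implicit Arguments.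

(** * Flat consequences of the moves: slides, bigons and twisted extrema *)

Lemma flat_exchange p q k :
  flat_sub [:: (p, 0); (q, k + width_out p)] [:: (q, k + width_in p); (p, 0)].
Proof. by apply: flat_sub_move; left; apply: (Exchange p q 0 k). Qed.

Lemma flat_exchange_rev p q k :
  flat_sub [:: (q, k + width_in p); (p, 0)] [:: (p, 0); (q, k + width_out p)].
Proof.
by apply: (flat_sub_rev (flat_exchange p q k)) => s t; rewrite exchange_run.
Qed.

Lemma shadow_quarter_turn x i :
  shadow_slice (Cross (quarter_turn x), i) = shadow_slice (Cross x, i).
Proof. by case: x. Qed.

(** The quarter turn made by the crossing is invisible in the shadow. *)
Lemma flat_cup_slide o x :
  flat_sub [:: (Cup o, 0); (Cross x, 1)] [:: (Cup o, 1); (Cross x, 0)].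
Proof.
apply: (flat_sub_trans (flat_sub_move (or_introl (Cup_slide o x 0))) _).
by apply: flat_sub_shadow; rewrite /= shadow_quarter_turn.
Qed.

Lemma flat_cup_slide_rev o x :
  flat_sub [:: (Cup o, 1); (Cross x, 0)] [:: (Cup o, 0); (Cross x, 1)].
Proof.
apply: (flat_sub_rev (flat_cup_slide o x) _).
by case=> [|a s] t //=; do 4!rewrite ?take0 ?drop0 /=.
Qed.

Lemma flat_cap_slide x :
  flat_sub [:: (Cross x, 1); (Cap, 0)] [:: (Cross x, 0); (Cap, 1)].
Proof.
apply: (flat_sub_trans (flat_sub_move (or_introl (Cap_slide x 0))) _).
by apply: flat_sub_shadow; rewrite /= shadow_quarter_turn.
Qed.

Lemma flat_cap_slide_rev x :
  flat_sub [:: (Cross x, 0); (Cap, 1)] [:: (Cross x, 1); (Cap, 0)].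
Proof.
apply: (flat_sub_rev (flat_cap_slide x) _).
by case=> [|a [|b [|c s]]] t //=; do 4!rewrite ?take0 ?drop0 /=.
Qed.

(** In the shadow a crossing is its own inverse: a second move cancels it against its opposite,
    which has the same shadow. *)
Lemma flat_bigon x : flat_sub [:: (Cross x, 0); (Cross x, 0)] [::].
Proof.
case: x => [x|]; last by apply: flat_sub_move; right; apply: (Omega2' 0).
apply: (@flat_sub_trans [:: (Cross (Real x), 0); (Cross (Real (~~ x)), 0)]).
  exact: flat_sub_shadow.
by apply: flat_sub_move; right; apply: (Omega2 x 0).
Qed.

Lemma flat_zigzag_left o : flat_sub [:: (Cup o, 0); (Cap, 1)] [::].
Proof. by apply: flat_sub_move; left; apply: (Zigzag_left o 0). Qed.

Lemma flat_zigzag_right o : flat_sub [:: (Cup o, 1); (Cap, 0)] [::].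
Proof. by apply: flat_sub_move; left; apply: (Zigzag_right o 0). Qed.

Lemma flat_kink o x : flat_sub [:: (Cup o, 1); (Cross x, 0); (Cap, 1)] [::].
Proof.
case: x => [x|]; apply: flat_sub_move; right; first exact: (Omega1_right o x 0).
exact: (Omega1'_right o 0).
Qed.

(* A kink on the right leg of a minimum is removed by a first move; sliding its
   crossing along its maximum and down to the left instead turns it into a twisted
   minimum followed by a zigzag. *)
Lemma flat_cup_untwist o x :
  flat_sub [:: (Cup (~~ o), 0)] [:: (Cup o, 0); (Cross x, 0)].
Proof.
apply: (@flat_sub_trans [:: (Cup (~~ o), 0); (Cup o, 2); (Cross x, 1); (Cap, 2)]).
  apply: flat_sub_rev.
    apply: (@flat_sub_ctx [:: (Cup (~~ o), 0)] [::] [:: (Cup o, 2); (Cross x, 1); (Cap, 2)] [::]).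
    by apply: (flat_sub_raise (k := 1) _ (flat_kink o x)).
  by case: o => s t; do 3!rewrite ?take0 ?drop0 /=.
apply: (@flat_sub_trans [:: (Cup o, 0); (Cup (~~ o), 0); (Cross x, 1); (Cap, 2)]).
  exact: (flat_sub_ctx [::] [:: (Cross x, 1); (Cap, 2)]
            (flat_exchange (Cup (~~ o)) (Cup o) 0)).
apply: (@flat_sub_trans [:: (Cup o, 0); (Cup (~~ o), 0); (Cross x, 2); (Cap, 1)]).
  apply: (@flat_sub_ctx [:: (Cup o, 0); (Cup (~~ o), 0)] [::]
            [:: (Cross x, 1); (Cap, 2)] [:: (Cross x, 2); (Cap, 1)]).
  by apply: (flat_sub_raise (k := 1) _ (flat_cap_slide_rev x)).
apply: (@flat_sub_trans [:: (Cup o, 0); (Cross x, 0); (Cup (~~ o), 0); (Cap, 1)]).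
  exact: (flat_sub_ctx [:: (Cup o, 0)] [:: (Cap, 1)]
            (flat_exchange (Cup (~~ o)) (Cross x) 0)).
exact: (flat_sub_ctx [:: (Cup o, 0); (Cross x, 0)] [::] (flat_zigzag_left (~~ o))).
Qed.

Lemma flat_cup_twist o x :
  flat_sub [:: (Cup o, 0); (Cross x, 0)] [:: (Cup (~~ o), 0)].
Proof.
apply: (flat_sub_rev (flat_cup_untwist o x) _).
by case: o => s t; do 4!rewrite ?take0 ?drop0 /=.
Qed.

(** The argument for minima turned upside down: a kink on the right leg of the maximum is slid over
    to the left. *)
Lemma flat_cap_untwist x : flat_sub [:: (Cap, 0)] [:: (Cross x, 0); (Cap, 0)].
Proof.
case=> [|a [|o s]] //.
(* The kink must carry the orientation [o] of the right leg, so the comparison is made at fixed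
   strands instead of through [flat_sub]. *)
apply: (@flat_at_trans _ [:: (Cup o, 2); (Cross x, 1); (Cap, 2); (Cap, 0)]).
  apply: flat_at_rev => [|t].
    apply: (@flat_sub_ctx [::] [:: (Cap, 0)] [:: (Cup o, 2); (Cross x, 1); (Cap, 2)] [::]).
    by apply: (flat_sub_raise (k := 1) _ (flat_kink o x)).
  by case: o a => -[]; do 4!rewrite ?take0 ?drop0 /=.
apply: (@flat_at_trans _ [:: (Cup o, 2); (Cross x, 1); (Cap, 0); (Cap, 0)]).
  exact: (flat_sub_ctx [:: (Cup o, 2); (Cross x, 1)] [::] (flat_exchange_rev Cap Cap 0)).
apply: (@flat_at_trans _ [:: (Cup o, 1); (Cross x, 2); (Cap, 0); (Cap, 0)]).
  apply: (@flat_sub_ctx [::] [:: (Cap, 0); (Cap, 0)]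
            [:: (Cup o, 2); (Cross x, 1)] [:: (Cup o, 1); (Cross x, 2)]).
  by apply: (flat_sub_raise (k := 1) _ (flat_cup_slide_rev o x)).
apply: (@flat_at_trans _ [:: (Cup o, 1); (Cap, 0); (Cross x, 0); (Cap, 0)]).
  exact: (flat_sub_ctx [:: (Cup o, 1)] [:: (Cap, 0)] (flat_exchange_rev Cap (Cross x) 0)).
exact: (flat_sub_ctx [::] [:: (Cross x, 0); (Cap, 0)] (flat_zigzag_right o)).
Qed.

Lemma flat_cap_twist x : flat_sub [:: (Cross x, 0); (Cap, 0)] [:: (Cap, 0)].
Proof.
apply: (flat_sub_rev (flat_cap_untwist x) _).
by case=> [|a [|b s]] t //; case: a b => -[]; do 4!rewrite ?take0 ?drop0 /=.
Qed.

(** * Moving a separated circle *)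

Definition circle (o : bool) (i : nat) : word bool := [:: (Cup o, i); (Cap, i)].

(** The circle crosses the strand on its left: a virtual bigon is created between them, one crossing
    slides past the minimum and the other past the maximum, and the bigon then cancels on the other
    side. *)
Lemma flat_circle_left o i : flat_sub (circle o i) (circle o 0).
Proof.
elim: i => [|i IHi]; first exact: flat_sub_refl.
apply: flat_sub_trans IHi.
apply: (@flat_sub_raise i (circle o 1) (circle o 0)) => //.
pose X := Cross (@Virtual bool).
apply: (@flat_sub_trans [:: (Cup o, 1); (X, 0); (X, 0); (Cap, 1)]).
  apply: flat_sub_rev; first exact: (flat_sub_ctx [:: (Cup o, 1)] [:: (Cap, 1)] (flat_bigon _)).
  by case=> [|a s] t //=; do 4!rewrite ?take0 ?drop0 /=.
apply: (@flat_sub_trans [:: (Cup o, 0); (X, 1); (X, 0); (Cap, 1)]).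
  exact: (flat_sub_ctx [::] [:: (X, 0); (Cap, 1)] (flat_cup_slide_rev o _)).
apply: (@flat_sub_trans [:: (Cup o, 0); (X, 1); (X, 1); (Cap, 0)]).
  exact: (flat_sub_ctx [:: (Cup o, 0); (X, 1)] [::] (flat_cap_slide_rev _)).
apply: (@flat_sub_ctx [:: (Cup o, 0)] [:: (Cap, 0)] [:: (X, 1); (X, 1)] [::]).
by apply: (flat_sub_raise (k := 1) _ (flat_bigon _)).
Qed.

(** A twist created at the minimum, reversing it, is absorbed by the maximum. *)
Lemma flat_circle_flip o : flat_sub (circle o 0) (circle true 0).
Proof.
case: o; first exact: flat_sub_refl.
apply: (@flat_sub_trans [:: (Cup true, 0); (Cross Virtual, 0); (Cap, 0)]).
  exact: (flat_sub_ctx [::] [:: (Cap, 0)] (flat_cup_untwist true Virtual)).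
exact: (flat_sub_ctx [:: (Cup true, 0)] [::] (flat_cap_twist Virtual)).
Qed.

(** At the far left the circle is exchanged with each slice of [v] in turn. *)
Lemma flat_circle_up o v : flat_sub (circle o 0 ++ v) (v ++ circle o 0).
Proof.
elim: v => [|[q k] v IHv]; first exact: flat_sub_refl.
apply: (@flat_sub_trans ((q, k) :: circle o 0 ++ v)); last first.
  by have := flat_sub_ctx [:: (q, k)] [::] IHv; rewrite !cats0.
apply: (@flat_sub_ctx [::] v [:: (Cup o, 0); (Cap, 0); (q, k)] [:: (q, k); (Cup o, 0); (Cap, 0)]).
apply: (@flat_sub_trans [:: (Cup o, 0); (q, k + 2); (Cap, 0)]).
  apply: (@flat_sub_ctx [:: (Cup o, 0)] [::] [:: (Cap, 0); (q, k)] [:: (q, k + 2); (Cap, 0)]).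
  by have := flat_exchange Cap q k; rewrite addn0.
apply: (@flat_sub_ctx [::] [:: (Cap, 0)] [:: (Cup o, 0); (q, k + 2)] [:: (q, k); (Cup o, 0)]).
by have := flat_exchange (Cup o) q k; rewrite addn0.
Qed.

(** A circle born anywhere ends up where [add_circle] puts its own; this recognises the smoothing of
    a kink as F(K) u U. *)
Lemma flat_circle o i v : flat_sub (circle o i ++ v) (v ++ circle true 0).
Proof.
apply: flat_sub_trans (flat_circle_up true v).
apply: (@flat_sub_ctx [::] v (circle o i) (circle true 0)).
exact: flat_sub_trans (flat_circle_left o i) (flat_circle_flip o).
Qed.

Set Implicit Arguments.

(** * Smoothings and moves *)

(** A list of at most one pair, sign and replacement word, so that slices without a real crossing
    contribute nothing to a concatenation. *)
Definition crossing_smoothing (s : seq bool) (e : slice bool) : seq (int * word bool) :=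
  if e is (Cross (Real x), i) then
    let: (a, b) := (nth true s i, nth true s i.+1) in
    [:: (if x (+) (a != b) then 1%R else (-1)%R,
         if a == b then [::] else [:: (Cap, i); (Cup b, i)])]
  else [::].

(* The pairs (w(c), L_c) for the real crossings c of w. *)
Fixpoint smoothings (s : seq bool) (w : word bool) : seq (int * word bool) :=
  if w is e :: w' then
    [seq (x.1, x.2 ++ w') | x <- crossing_smoothing s e] ++
    [seq (x.1, e :: x.2) | x <- smoothings (odflt [::] (pass s e)) w']
  else [::].

Lemma smoothings_cons s e w :
  smoothings s (e :: w) =
    [seq (x.1, x.2 ++ w) | x <- crossing_smoothing s e] ++
    [seq (x.1, e :: x.2) | x <- smoothings (odflt [::] (pass s e)) w].
Proof. by []. Qed.

Lemma smoothings_cat s s' u v : run s u = Some s' ->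
  smoothings s (u ++ v) =
    [seq (x.1, x.2 ++ v) | x <- smoothings s u] ++
    [seq (x.1, u ++ x.2) | x <- smoothings s' v].
Proof.
elim: u s => [|e u IHu] s.
  by case=> -> /=; rewrite -[LHS]map_id; apply: eq_map => -[].
rewrite run_cons /=; case: (pass s e) => //= s0 /IHu->.
rewrite !map_cat -!map_comp -catA; congr (_ ++ _).
by apply: eq_map => x /=; rewrite catA.
Qed.

Lemma crossing_smoothing_raise s1 s (e : slice bool) :
  crossing_smoothing (s1 ++ s) (e.1, e.2 + size s1) =
    [seq (x.1, raise (size s1) x.2) | x <- crossing_smoothing s e].
Proof.
have nth_s i : nth true (s1 ++ s) (i + size s1) = nth true s i.
  by rewrite nth_cat ltnNge leq_addl addnK.
by case: e => -[o||[x|]] i //=; rewrite -addSn !nth_s; case: eqP.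
Qed.

Lemma smoothings_raise s1 s t w : run s w = Some t ->
  smoothings (s1 ++ s) (raise (size s1) w) =
    [seq (x.1, raise (size s1) x.2) | x <- smoothings s w].
Proof.
elim: w s => [|e w IHw] s //; rewrite run_cons.
case pass_e: (pass s e) => [s'|] // /IHw{}IHw.
rewrite [raise _ (e :: w)]/= !smoothings_cons crossing_smoothing_raise.
rewrite pass_raise pass_e /= IHw map_cat -!map_comp.
by congr (_ ++ _); apply: eq_map => x //=; rewrite /raise map_cat.
Qed.

(** Smoothing respects orientations: exchanging two equal orientations changes nothing, and [Cup b]
    recreates the orientations [b], [~~ b] that crossing antiparallel strands would produce. *)
Lemma run_smoothings s t w x :
  run s w = Some t -> x \in smoothings s w -> run s x.2 = Some t.
Proof.
elim: w s x => [|e w IHw] s x //; rewrite run_cons.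
case pass_e: (pass s e) => [s'|] //= run_w; rewrite pass_e /= mem_cat.
case/orP=> /mapP[y y_w ->] /=; last by rewrite pass_e /=; apply: IHw.
rewrite run_cat; suff -> : run s y.2 = Some s' by [].
case: e pass_e y_w => -[o||[z|]] i //=; case Es: (drop i s) => [|a [|b s0]] //= [<-].
rewrite inE => /eqP->/=.
have sz_i : size (take i s) = i.
  rewrite size_takel // ltnW //; move: (congr1 size Es).
  by rewrite size_drop -subn_gt0 => ->.
have [-> ->] : nth true s i = a /\ nth true s i.+1 = b.
  by rewrite -[i in nth true s i]addn0 -addn1 -!nth_drop Es.
case: (eqVneq a b) => [eq_ab | neq_ab] /=.
  by rewrite -{1}(cat_take_drop i s) Es eq_ab.
rewrite Es neq_ab /= size_cat sz_i leq_addr.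
rewrite (take_size_cat _ sz_i) (drop_size_cat _ sz_i) /=.
by case: a b neq_ab {Es} => -[].
Qed.

(** The value 0 on words that are not diagrams is only a default. *)
Definition flat_gen (w : word bool) : M :=
  if flat_class w is Some l then (<< l >>)%R else 0%R.

(** * Balance of the crossings inside a move *)

Section Balance.
Local Open Scope ring_scope.

(* F stands for the flat class of a word in a fixed context and K for that of
   F(K) u U.  A separated circle only appears in a first move, whose right side is
   empty. *)
Definition balanced (s : seq bool) (l r : word bool) : Prop :=
  forall t (F : word bool -> M) (K : M), run s l = Some t ->
    (forall y y', flat_at s y y' -> run s y = Some t -> F y = F y') ->
    (r = [::] -> forall o j, run s (circle o j) = Some t -> F (circle o j) = K) ->
  \sum_(x <- smoothings s l) x.1 *: (F x.2 - K) =
  \sum_(x <- smoothings s r) x.1 *: (F x.2 - K).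

Lemma balanced_raise k l r : l <> [::] -> run_sub l r ->
  (forall s, balanced s l r) -> forall s, balanced s (raise k l) (raise k r).
Proof.
move=> l_neq0 sub_lr bal s; case: (leqP k (size s)) => [le_ks | lt_sk]; last first.
  by case: l l_neq0 {sub_lr bal} => // e l _ t F K; rewrite [raise _ _]/= run_cons pass_raise_out.
rewrite -(cat_take_drop k s); move: (take k s) (size_takel le_ks) => s0 <-.
move: (drop _ s) => s' t F K; rewrite run_raise; case run_l: run => [t'|] //= [<-] Fflat FK.
have run_r := sub_lr _ _ run_l.
rewrite (smoothings_raise _ run_l) (smoothings_raise _ run_r) !big_map.
(* Raising is absorbed into the arbitrary function [F]. *)
apply: (bal s' t' (fun y => F (raise (size s0) y)) K) => // [y y' yy' run_y | r0 o j run_c].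
  by apply: Fflat; [apply: flat_at_raise | rewrite run_raise run_y].
apply: (FK _ o (j + size s0)%N); first by rewrite r0.
by have := run_raise s0 s' (circle o j); rewrite run_c.
Qed.

Lemma balanced_virtual s l r :
  smoothings s l = [::] -> smoothings s r = [::] -> balanced s l r.
Proof. by move=> l0 r0 t F K _ _ _; rewrite l0 r0. Qed.

(** An exchange with a whole word is needed because an antiparallel smoothing replaces one slice by
    two. *)
Lemma flat_commute p y :
  flat_sub ((p, 0%N) :: raise (width_out p) y) (raise (width_in p) y ++ [:: (p, 0%N)]).
Proof.
elim: y => [|[q k] y IHy]; first exact: flat_sub_refl.
apply: (@flat_sub_trans ((q, k + width_in p)%N :: (p, 0%N) :: raise (width_out p) y)).
  exact: (flat_sub_ctx [::] (raise (width_out p) y) (flat_exchange p q k)).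
have := flat_sub_ctx [:: (q, k + width_in p)%N] [::] IHy.
by rewrite !cats0.
Qed.

(** Separates the strands [A] consumed and [B] produced by [p] from the strands [s0], on which [p]
    does not depend. *)
Lemma pass_bottom (p : piece bool) s s1 : pass s (p, 0%N) = Some s1 ->
  exists A B s0, [/\ s = A ++ s0, s1 = B ++ s0, size A = width_in p,
    size B = width_out p & forall s0', pass (A ++ s0') (p, 0%N) = Some (B ++ s0')].
Proof.
case: p => [o||x] /=; rewrite ?take0 ?drop0.
- by case=> <-; exists [::], [:: o; ~~ o], s; split=> // s0'; rewrite take0 drop0.
- case: s => [|a [|b s]] //; case: ifP => // ab [<-].
  by exists [:: a; b], [::], s; split=> // s0' /=; rewrite ab.
- by case: s => [|a [|b s]] // [<-]; exists [:: a; b], [:: b; a], s.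
Qed.

Lemma smoothings2 s s' e1 e2 : pass s e1 = Some s' ->
  smoothings s [:: e1; e2] =
    [seq (x.1, x.2 ++ [:: e2]) | x <- crossing_smoothing s e1] ++
    [seq (x.1, e1 :: x.2) | x <- crossing_smoothing s' e2].
Proof.
move=> pass1; rewrite !smoothings_cons pass1 [smoothings _ [::]]/= cats0 -map_comp.
by congr (_ ++ _); apply: eq_map => x /=; rewrite cats0.
Qed.

Lemma balanced_exchange p q k s :
  balanced s [:: (p, 0); (q, k + width_out p)]%N [:: (q, k + width_in p); (p, 0)]%N.
Proof.
move=> t F K run_l Fflat _; have run_r := run_l; rewrite exchange_run in run_r.
have run1 s' e : run s' [:: e] = pass (L := bool) s' e by rewrite /=; case: pass.
case pass1: (pass s (p, 0%N)) => [s1|]; last by rewrite run_cons pass1 in run_l.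
have [A [B [s0 [def_s def_s1 szA szB passA]]]] := pass_bottom pass1.
have pass2 := run_l; rewrite run_cons pass1 /obind /oapp run1 in pass2.
rewrite def_s1 -szB (pass_raise B s0 (q, k)) in pass2.
case passq: (pass s0 (q, k)) pass2 => [s0'|] // [def_t].
have pass_q : pass s (q, k + width_in p)%N = Some (A ++ s0').
  by rewrite def_s -szA (pass_raise A s0 (q, k)) passq.
have mem_r := fun x => @run_smoothings _ _ _ x run_r.
have mem_l := fun x => @run_smoothings _ _ _ x run_l.
move: mem_l mem_r; rewrite (smoothings2 _ pass1) (smoothings2 _ pass_q).
have -> : crossing_smoothing (A ++ s0') (p, 0%N) = crossing_smoothing s (p, 0%N).
  by rewrite def_s; case: (p) szA => [o||[z|]] //; case: (A) => [|a [|b []]].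
have -> : crossing_smoothing s (q, k + width_in p)%N =
    [seq (x.1, raise (width_in p) x.2) | x <- crossing_smoothing s0 (q, k)].
  by rewrite def_s -szA (crossing_smoothing_raise A s0 (q, k)).
have -> : crossing_smoothing s1 (q, k + width_out p)%N =
    [seq (x.1, raise (width_out p) x.2) | x <- crossing_smoothing s0 (q, k)].
  by rewrite def_s1 -szB (crossing_smoothing_raise B s0 (q, k)).
(* The crossings of [p] and [q] are met in opposite orders on the two sides, hence the permutation
   before matching. *)
rewrite -!map_comp => mem_l mem_r; rewrite (perm_big _ (permEl (perm_catC _ _))) !big_cat !big_map.
congr (_ + _); apply: eq_big_seq => x x_in; congr (_ *: (_ - _)).
  apply: Fflat => [|]; first exact: flat_commute.
  by apply: (mem_l (x.1, _)); rewrite mem_cat; apply/orP; right; apply/mapP; exists x.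
apply: Fflat => [|]; last first.
  by apply: (mem_l (x.1, _)); rewrite mem_cat; apply/orP; left; apply/mapP; exists x.
case: p x_in {run_l run_r mem_l mem_r pass1 passA szA szB pass_q} => [o||[z|]] //.
rewrite inE => /eqP->; rewrite [_.2]/=; case: ifP => _; first exact: flat_sub_refl.
move: (nth _ _ _) => c.
(* The maximum and the minimum left by an antiparallel smoothing of [p] pass [q] one after the
   other. *)
apply: (@flat_sub_trans [:: (Cap, 0); (q, k); (Cup c, 0)]%N).
  have := flat_sub_ctx [:: (Cap, 0%N)] [::] (flat_exchange (Cup c) q k).
  by rewrite addn0.
have := flat_sub_ctx [::] [:: (Cup c, 0%N)] (flat_exchange Cap q k).
by rewrite addn0.
Qed.

End Balance.

(** The slide replaces one leg of the minimum by the other, so the crossed strands are parallel on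
    exactly one side. The quarter turn compensates this in the sign; the antiparallel smoothing
    forms a zigzag that cancels. *)
Lemma balanced_cup_slide o x s :
  balanced s [:: (Cup o, 0); (Cross x, 1)] [:: (Cup o, 1); (Cross (quarter_turn x), 0)].
Proof.
case: x => [x|]; last exact: balanced_virtual.
case: s => [|a s] t F K; first by [].
have zig_r := flat_sub_ctx [::] [:: (Cup o, 0)] (flat_zigzag_right o).
have zig_l := flat_sub_ctx [::] [:: (Cup o, 1)] (flat_zigzag_left o).
rewrite /smoothings /= ?take0 ?drop0 !big_seq1 /=.
case: a o x zig_r zig_l => -[] -[] zig_r zig_l [<-] Fflat _ /=; congr (_ *: (_ - _))%R.
all: first [apply: (Fflat _ _ (zig_l _)) | apply/esym; apply: (Fflat _ _ (zig_r _))].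
all: by rewrite /= ?take0 ?drop0.
Qed.

Lemma balanced_cap_slide x s :
  balanced s [:: (Cross x, 1); (Cap, 0)] [:: (Cross (quarter_turn x), 0); (Cap, 1)].
Proof.
case: x => [x|]; last exact: balanced_virtual.
case: s => [|a [|b [|c s]]] t F K //.
have zig_r o := flat_sub_ctx [:: (Cap, 0)] [::] (flat_zigzag_left o).
have zig_l o := flat_sub_ctx [:: (Cap, 1)] [::] (flat_zigzag_right o).
rewrite /smoothings /= ?take0 ?drop0 !big_seq1 /=.
case: a b c x => -[] -[] // -[] // [<-] Fflat _ /=; congr (_ *: (_ - _))%R.
all: first [apply: (Fflat _ _ (zig_l _ _)) | apply/esym; apply: (Fflat _ _ (zig_r _ _))].
all: by rewrite /= ?take0 ?drop0.
Qed.

(** The maximum fits only if the strands at the crossing are parallel, so the smoothing always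
    leaves a circle beside the strand: its class is [K] and the term vanishes. *)
Lemma balanced_kink_right o x s :
  balanced s [:: (Cup o, 1); (Cross x, 0); (Cap, 1)] [::].
Proof.
case: x => [x|]; last exact: balanced_virtual.
case: s => [|a s] t F K; first by [].
rewrite /smoothings /= ?take0 ?drop0 !big_seq1 /= big_nil.
case: a o => -[] // [<-] _ Fcircle /=.
all: by rewrite (Fcircle erefl) ?subrr ?scaler0 //= ?take0 ?drop0.
Qed.

Lemma balanced_kink_left o x s :
  balanced s [:: (Cup o, 0); (Cross x, 1); (Cap, 0)] [::].
Proof.
case: x => [x|]; last exact: balanced_virtual.
case: s => [|a s] t F K; first by [].
rewrite /smoothings /= ?take0 ?drop0 !big_seq1 /= big_nil.
case: a o => -[] // [<-] _ Fcircle /=.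
all: by rewrite (Fcircle erefl) ?subrr ?scaler0 //= ?take0 ?drop0.
Qed.

(** The signs are opposite, so the two [K] cancel and equal flat smoothings suffice. For parallel
    strands one crossing of the same shadow remains on each side; for antiparallel ones it twists an
    extremum, which absorbs it. *)
Lemma balanced_bigon x s :
  balanced s [:: (Cross (Real x), 0); (Cross (Real (~~ x)), 0)] [::].
Proof.
case: s => [|a [|b s]] t F K // [<-] Fflat _.
rewrite /smoothings /= !big_cons !big_nil !addr0 /= [b == a]eq_sym addNb.
have -> : (if ~~ (x (+) (a != b)) then 1 else -1 : int)%R =
          (- (if x (+) (a != b) then 1 else -1))%R.
  by case: (_ (+) _); rewrite ?opprK.
rewrite scaleNr -scalerBr [X in (_ *: X)%R](_ : _ = 0%R) ?scaler0 //.
apply/eqP; rewrite opprB addrA subrK subr_eq0; apply/eqP.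
have [eq_ab | neq_ab] := eqVneq a b.
  by apply: Fflat; [apply: flat_sub_shadow | rewrite eq_ab].
have def_a : a = ~~ b by case: (a) (b) neq_ab => -[].
rewrite {}def_a {neq_ab} in Fflat *.
transitivity (F [:: (Cap, 0); (Cup (~~ b), 0)]).
  apply: Fflat.
    exact: (flat_sub_ctx [:: (Cap, 0)] [::] (flat_cup_twist b (Real (~~ x)))).
  by case: (b); rewrite /= ?take0 ?drop0.
apply/esym/Fflat.
  exact: (flat_sub_ctx [::] [:: (Cup (~~ b), 0)] (flat_cap_twist (Real x))).
by case: (b); rewrite /= ?take0 ?drop0.
Qed.

Definition oriented_smoothing (a b : bool) (i : nat) : word bool :=
  if a == b then [::] else [:: (Cap, i); (Cup b, i)].

Section Triangle.
Variables (a b c : bool) (s : seq bool) (F : word bool -> M) (y z : crossing bool).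
Hypothesis same_kind : shadow_slice (Cross y, 0) = shadow_slice (Cross z, 0).
Hypothesis Fflat : forall w w', flat_at [:: a, b, c & s] w w' ->
  run [:: a, b, c & s] w = Some [:: c, b, a & s] -> F w = F w'.

Lemma same_kind_at i : shadow_slice (Cross y, i) = shadow_slice (Cross z, i).
Proof. by move: same_kind; rewrite /shadow_slice /= => -[->]. Qed.

(** Here [y] and [z] are the two crossings left after smoothing. If [a] and [b] are antiparallel,
    the extremum facing them slides across the third strand and they cancel as a bigon; both sides
    reduce to [(Cap, 0)] below [(Cup b, 1)]. *)
Lemma triangle_smoothing12 :
  F (oriented_smoothing a b 0 ++ [:: (Cross y, 1); (Cross z, 0)]) =
  F ([:: (Cross z, 1); (Cross y, 0)] ++ oriented_smoothing a b 1).
Proof.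
rewrite /oriented_smoothing; case: eqVneq => [eq_ab | neq_ab].
  by apply: Fflat; [apply: flat_sub_shadow; rewrite /= !same_kind_at | rewrite eq_ab].
have def_a : a = ~~ b by case: (a) (b) neq_ab => -[].
move: Fflat; rewrite def_a => Ff.
transitivity (F [:: (Cap, 0); (Cup b, 1)]); last apply: esym.
all: apply: Ff; last by case: (b); rewrite /= ?take0 ?drop0.
  apply: (@flat_sub_trans [:: (Cap, 0); (Cup b, 0); (Cross z, 1); (Cross z, 0)]).
    by apply: flat_sub_shadow; rewrite /= !same_kind_at.
  apply: (@flat_sub_trans [:: (Cap, 0); (Cup b, 1); (Cross z, 0); (Cross z, 0)]).
    exact: (flat_sub_ctx [:: (Cap, 0)] [:: (Cross z, 0)] (flat_cup_slide b z)).
  exact: (flat_sub_ctx [:: (Cap, 0); (Cup b, 1)] [::] (flat_bigon z)).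
apply: (@flat_sub_trans [:: (Cross z, 1); (Cross z, 0); (Cap, 1); (Cup b, 1)]).
  by apply: flat_sub_shadow; rewrite /= !same_kind_at.
apply: (@flat_sub_trans [:: (Cross z, 1); (Cross z, 1); (Cap, 0); (Cup b, 1)]).
  exact: (flat_sub_ctx [:: (Cross z, 1)] [:: (Cup b, 1)] (flat_cap_slide_rev z)).
apply: (@flat_sub_ctx [::] [:: (Cap, 0); (Cup b, 1)] [:: (Cross z, 1); (Cross z, 1)] [::]).
by apply: (flat_sub_raise (k := 1) _ (flat_bigon z)).
Qed.

(** For parallel outer strands the remaining crossings form a bigon on both sides. For antiparallel
    ones the middle strand is slid past the maximum and then past the minimum. *)
Lemma triangle_smoothing13 :
  F ([:: (Cross y, 0)] ++ oriented_smoothing a c 1 ++ [:: (Cross z, 0)]) =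
  F ([:: (Cross z, 1)] ++ oriented_smoothing a c 0 ++ [:: (Cross y, 1)]).
Proof.
rewrite /oriented_smoothing; case: eqVneq => [eq_ac | neq_ac].
  transitivity (F [::]); last apply: esym.
  1,2: apply: Fflat; last by rewrite eq_ac.
    apply: (@flat_sub_trans [:: (Cross z, 0); (Cross z, 0)]).
      by apply: flat_sub_shadow; rewrite /= !same_kind_at.
    exact: flat_bigon.
  apply: (@flat_sub_trans [:: (Cross z, 1); (Cross z, 1)]).
    by apply: flat_sub_shadow; rewrite /= !same_kind_at.
  by apply: (flat_sub_raise (k := 1) _ (flat_bigon z)).
have def_a : a = ~~ c by case: (a) (c) neq_ac => -[].
move: Fflat; rewrite def_a => Ff.
apply: Ff; last by case: (c); rewrite /= ?take0 ?drop0.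
apply: (@flat_sub_trans [:: (Cross z, 0); (Cap, 1); (Cup c, 1); (Cross z, 0)]).
  by apply: flat_sub_shadow; rewrite /= !same_kind_at.
apply: (@flat_sub_trans [:: (Cross z, 1); (Cap, 0); (Cup c, 1); (Cross z, 0)]).
  exact: (flat_sub_ctx [::] [:: (Cup c, 1); (Cross z, 0)] (flat_cap_slide_rev z)).
apply: (@flat_sub_trans [:: (Cross z, 1); (Cap, 0); (Cup c, 0); (Cross z, 1)]).
  exact: (flat_sub_ctx [:: (Cross z, 1); (Cap, 0)] [::] (flat_cup_slide_rev c z)).
by apply: flat_sub_shadow; rewrite /= !same_kind_at.
Qed.

Lemma triangle_smoothing23 :
  F ([:: (Cross y, 0); (Cross z, 1)] ++ oriented_smoothing b c 0) =
  F (oriented_smoothing b c 1 ++ [:: (Cross z, 0); (Cross y, 1)]).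
Proof.
rewrite /oriented_smoothing; case: eqVneq => [eq_bc | neq_bc].
  by apply: Fflat; [apply: flat_sub_shadow; rewrite /= !same_kind_at | rewrite eq_bc].
have def_b : b = ~~ c by case: (b) (c) neq_bc => -[].
move: Fflat; rewrite def_b => Ff.
transitivity (F [:: (Cap, 1); (Cup c, 0)]); last apply: esym.
all: apply: Ff; last by case: (c); rewrite /= ?take0 ?drop0.
  apply: (@flat_sub_trans [:: (Cross z, 0); (Cross z, 1); (Cap, 0); (Cup c, 0)]).
    by apply: flat_sub_shadow; rewrite /= !same_kind_at.
  apply: (@flat_sub_trans [:: (Cross z, 0); (Cross z, 0); (Cap, 1); (Cup c, 0)]).
    exact: (flat_sub_ctx [:: (Cross z, 0)] [:: (Cup c, 0)] (flat_cap_slide z)).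
  exact: (flat_sub_ctx [::] [:: (Cap, 1); (Cup c, 0)] (flat_bigon z)).
apply: (@flat_sub_trans [:: (Cap, 1); (Cup c, 1); (Cross z, 0); (Cross z, 1)]).
  by apply: flat_sub_shadow; rewrite /= !same_kind_at.
apply: (@flat_sub_trans [:: (Cap, 1); (Cup c, 0); (Cross z, 1); (Cross z, 1)]).
  exact: (flat_sub_ctx [:: (Cap, 1)] [:: (Cross z, 1)] (flat_cup_slide_rev c z)).
apply: (@flat_sub_ctx [:: (Cap, 1); (Cup c, 0)] [::] [:: (Cross z, 1); (Cross z, 1)] [::]).
by apply: (flat_sub_raise (k := 1) _ (flat_bigon z)).
Qed.

End Triangle.

Lemma balanced_triangle ab ac bc s :
    reidemeister_move (triangle_below ab ac bc 0) (triangle_above ab ac bc 0) ->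
  balanced s (triangle_below ab ac bc 0) (triangle_above ab ac bc 0).
Proof.
case: s => [|a [|b [|c s]]] // mv t F K [<-] Fflat _.
have E12 y z kyz := triangle_smoothing12 (y := y) (z := z) kyz Fflat.
have E13 y z kyz := triangle_smoothing13 (y := y) (z := z) kyz Fflat.
have E23 y z kyz := triangle_smoothing23 (y := y) (z := z) kyz Fflat.
rewrite /oriented_smoothing /= in E12 E13 E23.
(* In every third move, once one crossing is real the other two are of the same kind: both real in
   [Omega3], both virtual in the mixed moves. *)
have [kABAC kACBC kABBC] : [/\
  (if bc is Real _ then shadow_slice (Cross ab, 0) = shadow_slice (Cross ac, 0) else True),
  (if ab is Real _ then shadow_slice (Cross ac, 0) = shadow_slice (Cross bc, 0) else True) &
  (if ac is Real _ then shadow_slice (Cross ab, 0) = shadow_slice (Cross bc, 0) else True)].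
  by inversion mv.
rewrite /smoothings /=.
case: ab ac bc kABAC kACBC kABBC {mv} => [x|] [y|] [z|] //= k1 k2 k3;
  rewrite ?big_cons ?big_nil ?addr0 //= ?cats0.
all: rewrite ?E12 ?E13 ?E23 //.
(* With three real crossings, the two sides list the paired terms in opposite orders. *)
by rewrite addrC -addrA [RHS]addrCA.
Qed.

Lemma move_balanced l r : move l r -> forall s, balanced s l r.
Proof.
have at_height i l0 r0 : l0 <> [::] -> move l0 r0 ->
    (forall s, balanced s l0 r0) -> forall s, balanced s (raise i l0) (raise i r0).
  by move=> l0_neq0 /move_run_sub; apply: balanced_raise.
have triangle i ab ac bc :
    reidemeister_move (triangle_below ab ac bc 0) (triangle_above ab ac bc 0) ->
    forall s, balanced s (triangle_below ab ac bc i) (triangle_above ab ac bc i).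
  move=> mv; apply: (at_height i (triangle_below ab ac bc 0) (triangle_above ab ac bc 0)) => //.
    by right.
  by move=> s; apply: balanced_triangle.
case=> [[p q i k|o i|o i|o x i|x i]
       | [o x i|o x i|x i|x y z i xyz|o i|o i|i|i|x i|x i|x i]].
- have := at_height i [:: (p, 0); (q, k + width_out p)] [:: (q, k + width_in p); (p, 0)].
  have addE n : k + n + i = i + k + n by rewrite addnAC [k + i]addnC.
  rewrite /raise /= add0n !addE; apply=> //.
    by left; apply: (Exchange p q 0 k).
  exact: balanced_exchange.
- apply: (at_height i [:: (Cup o, 0); (Cap, 1)] [::]) => //.
  by left; apply: (Zigzag_left o 0).
- apply: (at_height i [:: (Cup o, 1); (Cap, 0)] [::]) => //.
  by left; apply: (Zigzag_right o 0).
- apply: (at_height i [:: (Cup o, 0); (Cross x, 1)]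
            [:: (Cup o, 1); (Cross (quarter_turn x), 0)]) => //.
    by left; apply: (Cup_slide o x 0).
  exact: balanced_cup_slide.
- apply: (at_height i [:: (Cross x, 1); (Cap, 0)]
            [:: (Cross (quarter_turn x), 0); (Cap, 1)]) => //.
    by left; apply: (Cap_slide x 0).
  exact: balanced_cap_slide.
- apply: (at_height i [:: (Cup o, 1); (Cross (Real x), 0); (Cap, 1)] [::]) => //.
    by right; apply: (Omega1_right o x 0).
  exact: balanced_kink_right.
- apply: (at_height i [:: (Cup o, 0); (Cross (Real x), 1); (Cap, 0)] [::]) => //.
    by right; apply: (Omega1_left o x 0).
  exact: balanced_kink_left.
- apply: (at_height i [:: (Cross (Real x), 0); (Cross (Real (~~ x)), 0)] [::]) => //.
    by right; apply: (Omega2 x 0).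
  exact: balanced_bigon.
- by apply: triangle; apply: Omega3.
- by move=> s; apply: balanced_virtual.
- by move=> s; apply: balanced_virtual.
- by move=> s; apply: balanced_virtual.
- by move=> s; apply: balanced_virtual.
- by apply: triangle; apply: Omega3v_A.
- by apply: triangle; apply: Omega3v_B.
- by apply: triangle; apply: Omega3v_C.
Qed.

(** * The sum over all crossings of a diagram *)

Section CrossingSum.
Local Open Scope ring_scope.

(** Passes from sums over positions to the recursive list. The prefix [u] already read carries the
    induction, and [f] is arbitrary so as to serve both the smoothings and the writhe. *)
Lemma sum_smoothings (V : zmodType) (f : int -> word bool -> V) u s w t :
    run [::] u = Some s -> run s w = Some t ->
  \sum_(c < size w | is_real (u ++ w) (size u + c)%N)
      f (sign (u ++ w) (size u + c)%N) (smooth_word (u ++ w) (size u + c)%N) =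
  \sum_(x <- smoothings s w) f x.1 (u ++ x.2).
Proof.
elim: w u s => [|e w IHw] u s run_u; first by rewrite big_ord0 big_nil.
rewrite run_cons; case pass_e: (pass s e) => [s'|] // run_w.
have run_ue : run [::] (rcons u e) = Some s'.
  by rewrite -cats1 run_cat run_u /= pass_e.
have {IHw} := IHw (rcons u e) s' run_ue run_w.
rewrite size_rcons cat_rcons big_mkcond => IHw.
rewrite smoothings_cons pass_e [odflt _ _]/= -[size (e :: w)]/(size w).+1 big_cat !big_map [LHS]big_mkcond.
rewrite big_ord_recl; congr (_ + _).
  rewrite addn0 /is_real /sign /smooth_word /strands_at nth_cat ltnn subnn /=.
  rewrite take_size_cat // run_u [odflt _ _]/=.
  case: e {pass_e IHw run_ue} => -[o||[x|]] i /=; rewrite ?big_nil // big_seq1 /=.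
  by rewrite -[u ++ _ :: w]cat_rcons drop_size_cat ?size_rcons.
transitivity (\sum_(x <- smoothings s' w) f x.1 (rcons u e ++ x.2)).
  by rewrite -IHw; apply: eq_bigr => c _; rewrite lift0 addnS addSn.
by apply: eq_bigr => x _; rewrite cat_rcons.
Qed.

(** The term w(K) (F(K) u U) is distributed over the crossings, which makes the invariance local. *)
Definition crossing_sum (w : word bool) : M :=
  \sum_(x <- smoothings [::] w)
    x.1 *: (flat_gen x.2 - flat_gen (w ++ circle true 0)).

Lemma crossing_sum_move u l r v :
    move l r -> run [::] (u ++ l ++ v) = Some [::] ->
    run [::] (u ++ r ++ v) = Some [::] ->
  crossing_sum (u ++ l ++ v) = crossing_sum (u ++ r ++ v).
Proof.
move=> mlr valid_l valid_r; rewrite /crossing_sum.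
(* The same move, followed by [v] and the circle, identifies the subtracted terms. *)
have -> : flat_gen ((u ++ l ++ v) ++ circle true 0) =
          flat_gen ((u ++ r ++ v) ++ circle true 0).
  have valid_circle w : run [::] w = Some [::] -> run [::] (w ++ circle true 0) = Some [::].
    by rewrite run_cat => ->.
  have := valid_circle _ valid_r; have := valid_circle _ valid_l.
  by rewrite /flat_gen -!catA => wl wr; rewrite (flat_class_move mlr wl wr).
move: (valid_l) (valid_r); rewrite !run_cat; case run_u: (run _ u) => [s|] //=.
rewrite !run_cat; case run_l: (run s l) => [t|] //= run_v.
have run_r := move_run_sub mlr run_l; rewrite run_r /= => _.
set K := flat_gen _.
rewrite !(smoothings_cat _ run_u) (smoothings_cat v run_l) (smoothings_cat v run_r).
(* Three groups of crossings: after smoothing in [u] or in [v] the move still applies, and those of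
   the moved part are compared by balance. *)
rewrite !map_cat !big_cat !big_map /=; congr (_ + (_ + _)).
- apply: eq_big_seq => x /(run_smoothings run_u) run_x.
  rewrite /flat_gen (@flat_class_move x.2 l r v) //.
    by rewrite run_cat run_x /= run_cat run_l.
  by rewrite run_cat run_x /= run_cat run_r.
- have raise0 y : raise 0 y = y.
    by rewrite /raise -[RHS]map_id; apply: eq_map => -[p i]; rewrite addn0.
  apply: (move_balanced mlr (F := fun y => flat_gen (u ++ y ++ v)) run_l).
    move=> y y' /[apply] -[_ /(_ [::] u v run_u run_v)].
    by rewrite /= !raise0 /flat_gen => ->.
  move=> r0 o j run_c; rewrite /K /flat_gen r0 /= -catA.
  have run_cv : run s (circle o j ++ v) = Some [::] by rewrite run_cat run_c.
  have [_ eq_cv] := flat_circle o j v s [::] run_cv.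
  have := eq_cv [::] u [::] run_u erefl.
  by rewrite -[size [::]]/0%N !raise0 !cats0 => ->.
- apply: eq_big_seq => x /(run_smoothings run_v) run_x.
  rewrite /flat_gen (@flat_class_move u l r x.2) //.
    by rewrite run_cat run_u /= run_cat run_l.
  by rewrite run_cat run_u /= run_cat run_r.
Qed.

End CrossingSum.

(** * Counting components *)

(* Strands from left to right, with their orientations and the labels used by
   closed_circles. *)
Definition strands := seq (bool * nat).

Implicit Types (z A B C : strands) (w : word bool).

Definition ncircles (n : nat) z w := closed_circles n (unzip2 z) w.

Definition relabel (f : nat -> nat) z : strands := [seq (x.1, f x.2) | x <- z].

Definition merge (p q : nat) (r : nat) := if r == q then p else r.

Lemma unzip1_relabel f z : unzip1 (relabel f z) = unzip1 z.
Proof. by rewrite /unzip1 -map_comp. Qed.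

Lemma unzip2_relabel f z : unzip2 (relabel f z) = map f (unzip2 z).
Proof. by rewrite /unzip2 -!map_comp. Qed.

Lemma relabel_comp f g z : relabel f (relabel g z) = relabel (f \o g) z.
Proof. by rewrite /relabel -map_comp. Qed.

(** The slice closes [k] circles, and labels are fresh from [m] on afterwards. Splitting the strands
    as concatenations replaces the positional form of [pass] and [closed_circles]. *)
Inductive strand_step n : strands -> slice bool -> nat -> nat -> strands -> Prop :=
| StepCup A C o :
    strand_step n (A ++ C) (Cup o, size A) 0 n.+1 (A ++ (o, n) :: (~~ o, n) :: C)
| StepCap A C a b : a.1 != b.1 ->
    strand_step n (A ++ a :: b :: C) (Cap, size A) (a.2 == b.2) n
      (relabel (merge a.2 b.2) (A ++ C))
| StepCross A C a b x :
    strand_step n (A ++ a :: b :: C) (Cross x, size A) 0 n (A ++ b :: a :: C).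

Lemma ncircles_step n z e k m z' w : strand_step n z e k m z' ->
  ncircles n z (e :: w) = k + ncircles m z' w.
Proof.
have take_s A C : take (size A) (unzip2 (A ++ C)) = unzip2 A.
  by rewrite /unzip2 -map_take take_size_cat.
have drop_s A C : drop (size A) (unzip2 (A ++ C)) = unzip2 C.
  by rewrite /unzip2 -map_drop drop_size_cat.
have drop2_s A C a b : drop (size A).+2 (unzip2 (A ++ a :: b :: C)) = unzip2 C.
  by rewrite -add2n -drop_drop drop_s /= drop0.
have nth_s A C j : nth 0 (unzip2 (A ++ C)) (j + size A) = nth 0 (unzip2 C) j.
  by rewrite /unzip2 map_cat nth_cat size_map ltnNge leq_addl addnK.
case=> {z e k m z'} [A C o|A C a b _|A C a b x]; rewrite /ncircles /=.
- by rewrite take_s drop_s /unzip2 map_cat.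
- rewrite take_s drop2_s (nth_s A (a :: b :: C) 0) (nth_s A (a :: b :: C) 1) /=.
  by rewrite unzip2_relabel; congr (_ + closed_circles n (map _ _) w); rewrite /unzip2 map_cat.
- rewrite take_s drop2_s (nth_s A (a :: b :: C) 0) (nth_s A (a :: b :: C) 1) /=.
  by rewrite /unzip2 map_cat.
Qed.

Lemma pass_step n z e s : pass (unzip1 z) e = Some s ->
  exists k m z', strand_step n z e k m z' /\ unzip1 z' = s.
Proof.
have split2 i : drop i (unzip1 z) = [seq x.1 | x <- drop i z] by rewrite map_drop.
case: e => -[o||x] i /=.
- case: ifP => // le_iz [<-]; rewrite size_map in le_iz.
  exists 0, n.+1, (take i z ++ (o, n) :: (~~ o, n) :: drop i z).
  split; last by rewrite /unzip1 map_cat /= map_take map_drop.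
  have := StepCup n (take i z) (drop i z) o.
  by rewrite cat_take_drop size_takel.
- rewrite split2; case Ez: (drop i z) => [|a [|b C]] //=; case: ifP => // ab [<-].
  have sz_i : size (take i z) = i.
    by rewrite size_takel // ltnW // -subn_gt0 -size_drop Ez.
  exists (a.2 == b.2), n, (relabel (merge a.2 b.2) (take i z ++ C)).
  split; last by rewrite unzip1_relabel /unzip1 map_cat map_take.
  have := StepCap n (take i z) C ab.
  by rewrite -Ez cat_take_drop sz_i.
- rewrite split2; case Ez: (drop i z) => [|a [|b C]] //= [<-].
  have sz_i : size (take i z) = i.
    by rewrite size_takel // ltnW // -subn_gt0 -size_drop Ez.
  exists 0, n, (take i z ++ b :: a :: C).
  split; last by rewrite /unzip1 map_cat map_take.
  have := StepCross n (take i z) C a b x.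
  by rewrite -Ez cat_take_drop sz_i.
Qed.

Lemma run_step n z e w t : run (unzip1 z) (e :: w) = Some t ->
  exists k m z', strand_step n z e k m z' /\ run (unzip1 z') w = Some t.
Proof.
rewrite run_cons; case pass_e: (pass _ e) => [s|] //= run_w.
have [k [m [z' [step_e def_s]]]] := pass_step n pass_e.
by exists k, m, z'; rewrite def_s.
Qed.

Definition below (n : nat) z := forall p, p \in unzip2 z -> p < n.

Lemma below_relabel n f z :
  (forall p, p \in unzip2 z -> f p < n) -> below n (relabel f z).
Proof. by move=> lt_f p; rewrite unzip2_relabel => /mapP[q /lt_f ? ->]. Qed.

Lemma mem_unzip2 z x : x \in z -> x.2 \in unzip2 z.
Proof. exact: map_f. Qed.

(** The count depends only on which strands share a label, not on the labels. *)
Lemma ncircles_relabel f n m z w t :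
    {in unzip2 z &, injective f} -> below n z -> below m (relabel f z) ->
    run (unzip1 z) w = Some t ->
  ncircles m (relabel f z) w = ncircles n z w.
Proof.
elim: w f n m z => [|e w IHw] f n m z f_inj lt_n lt_m //.
case/(run_step n)=> k [n' [z' [step_e run_w]]].
rewrite (ncircles_step _ step_e).
case: step_e f_inj lt_n lt_m run_w => {z e k n' z'} [A C o|A C a b ab|A C a b x] f_inj lt_n lt_m run_w.
(* A new arc is labelled [n] on one side and [m] on the other, so the renaming is extended
   accordingly. *)
- pose g p := if p == n then m else f p.
  have g_AC : {in unzip2 (A ++ C), g =1 f}.
    by move=> p /lt_n; rewrite /g; case: eqP => // ->; rewrite ltnn.
  have rel_g D : {subset D <= A ++ C} -> relabel g D = relabel f D.
    by move=> sDAC; apply/eq_in_map => y /sDAC/mem_unzip2/g_AC ->.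
  have sA : {subset A <= A ++ C} by move=> y; rewrite mem_cat => ->.
  have sC : {subset C <= A ++ C} by move=> y; rewrite mem_cat orbC => ->.
  have E : relabel g (A ++ (o, n) :: (~~ o, n) :: C) =
           relabel f A ++ (o, m) :: (~~ o, m) :: relabel f C.
    by rewrite /relabel map_cat /= -!/(relabel _ _) !rel_g // /g eqxx.
  have -> : relabel f (A ++ C) = relabel f A ++ relabel f C by rewrite /relabel map_cat.
  have := ncircles_step w (StepCup m (relabel f A) (relabel f C) o).
  rewrite size_map => ->; rewrite !add0n -E.
  have labels p : p \in unzip2 (A ++ (o, n) :: (~~ o, n) :: C) ->
      p = n \/ p \in unzip2 (A ++ C).
    rewrite /unzip2 !map_cat !mem_cat /= !inE.
    by case: eqP => [|_]; [left | right].
  have lt_f p : p \in unzip2 (A ++ C) -> f p < m.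
    by move=> p_in; apply: lt_m; rewrite unzip2_relabel map_f.
  apply: (IHw g _ _ _ _ _ _ run_w).
  + move=> p q /labels p_in /labels q_in; rewrite /g.
    case: eqP p_in => [-> _ | neq_pn [//|p_in]]; case: eqP q_in => [-> _ | neq_qn [//|q_in]] //.
    * by move=> def_m; have := lt_f _ q_in; rewrite -def_m ltnn.
    * by move=> def_m; have := lt_f _ p_in; rewrite def_m ltnn.
    * exact: f_inj.
  + by move=> p /labels[-> // | /lt_n/ltnW].
  + apply: below_relabel => p /labels[-> | p_in]; rewrite /g ?eqxx //.
    by rewrite -/(g p) g_AC // ltnS ltnW ?lt_f.
- have sAC : {subset unzip2 (A ++ C) <= unzip2 (A ++ a :: b :: C)}.
    move=> p; rewrite /unzip2 !map_cat !mem_cat /= !inE.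
    by case/orP=> ->; rewrite ?orbT.
  have a_in : a.2 \in unzip2 (A ++ a :: b :: C).
    by apply: mem_unzip2; rewrite mem_cat mem_head orbT.
  have b_in : b.2 \in unzip2 (A ++ a :: b :: C).
    by apply: mem_unzip2; rewrite mem_cat !inE eqxx !orbT.
  have merge_in p : p \in unzip2 (A ++ C) -> merge a.2 b.2 p \in unzip2 (A ++ a :: b :: C).
    by move=> p_in; rewrite /merge; case: ifP => // _; apply: sAC.
  have -> : relabel f (A ++ a :: b :: C) =
      relabel f A ++ (a.1, f a.2) :: (b.1, f b.2) :: relabel f C.
    by rewrite /relabel map_cat.
  have := ncircles_step w (StepCap m (relabel f A) (relabel f C)
            (a := (a.1, f a.2)) (b := (b.1, f b.2)) ab).
  rewrite size_map => -> /=; congr (_ + _).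
    by congr nat_of_bool; apply/eqP/eqP => [/f_inj-> | ->].
  have E : relabel (merge (f a.2) (f b.2)) (relabel f A ++ relabel f C) =
      relabel f (relabel (merge a.2 b.2) (A ++ C)).
    rewrite -map_cat !relabel_comp; apply/eq_in_map => y /mem_unzip2 y_in /=.
    congr (_, _); rewrite /merge; have [-> | neq_yb] := eqVneq y.2 b.2; first by rewrite eqxx.
    by case: eqP => // /f_inj; rewrite (sAC _ y_in) b_in => /(_ isT isT) eq_yb; rewrite eq_yb eqxx in neq_yb.
  rewrite E; apply: (IHw f _ _ _ _ _ _ run_w).
  + move=> p q; rewrite unzip2_relabel => /mapP[p' p'_in ->] /mapP[q' q'_in ->].
    by apply: f_inj; apply: merge_in.
  + by apply: below_relabel => p /merge_in/lt_n.
  + apply: below_relabel => p; rewrite unzip2_relabel => /mapP[q /merge_in q_in ->].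
    by apply: lt_m; rewrite unzip2_relabel map_f.
- have perm_AC : unzip2 (A ++ b :: a :: C) =i unzip2 (A ++ a :: b :: C).
    by move=> p; rewrite /unzip2 !map_cat !mem_cat /= !inE; congr (_ || _); rewrite orbCA.
  have -> : relabel f (A ++ a :: b :: C) =
      relabel f A ++ (a.1, f a.2) :: (b.1, f b.2) :: relabel f C.
    by rewrite /relabel map_cat.
  have := ncircles_step w (StepCross m (relabel f A) (relabel f C)
            (a.1, f a.2) (b.1, f b.2) x).
  rewrite size_map => -> /=; rewrite !add0n.
  have -> : relabel f A ++ (b.1, f b.2) :: (a.1, f a.2) :: relabel f C =
      relabel f (A ++ b :: a :: C) by rewrite /relabel map_cat.
  apply: (IHw f _ _ _ _ _ _ run_w).
  + by move=> p q; rewrite !perm_AC; apply: f_inj.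
  + by move=> p; rewrite perm_AC; apply: lt_n.
  + by apply: below_relabel => p; rewrite perm_AC => p_in; apply: lt_m; rewrite unzip2_relabel map_f.
Qed.

Lemma neq_negb (a b : bool) : a != b -> a = ~~ b.
Proof. by case: a b => -[]. Qed.

(** * Pairing of the strands by the arcs below them *)

(** Each label present is carried by exactly two strands, one up and one down: the ends of an
    oriented arc. *)
Definition paired z := uniq z /\ forall x, x \in z -> (~~ x.1, x.2) \in z.

Lemma paired_perm z z' : perm_eq z z' -> paired z -> paired z'.
Proof.
move=> zz' [uz fz]; split; first by rewrite -(perm_uniq zz').
by move=> x; rewrite -!(perm_mem zz'); apply: fz.
Qed.

Lemma perm_strands A C a b : perm_eq (A ++ a :: b :: C) (a :: b :: A ++ C).
Proof. by rewrite -[a :: b :: C]/([:: a; b] ++ C) perm_catCA. Qed.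

Lemma below_perm n z z' : perm_eq z z' -> below n z -> below n z'.
Proof. by move=> zz' lt_n p; rewrite -(perm_mem (perm_map snd zz')); apply: lt_n. Qed.

Lemma paired_merge a b z : a.1 != b.1 -> paired (a :: b :: z) ->
  paired (relabel (merge a.2 b.2) z).
Proof.
case: a b => [d p] [e q] /= neq_de.
have {e neq_de}-> : e = ~~ d by apply: neq_negb; rewrite eq_sym.
rewrite /paired /= !inE negb_or => -[/and3P[/andP[_ a_notin] b_notin uz] fz].
have in_z x : x \in z -> [/\ x != (d, p), x != (~~ d, q) &
    (~~ x.1, x.2) = (d, p) \/ (~~ x.1, x.2) = (~~ d, q) \/ (~~ x.1, x.2) \in z].
  move=> x_in; have := fz x; rewrite !inE x_in !orbT => /(_ isT)/or3P xf.
  split; first by apply: contraNneq a_notin => <-.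
    by apply: contraNneq b_notin => <-.
  by case: xf => [/eqP|/eqP|]; auto.
split.
  (* Two strands could be identified only if they had the same orientation and labels [p] and [q];
     one of them would then be a strand removed by the maximum. *)
  rewrite map_inj_in_uniq // => -[o r] [o' r'] /in_z[/= na nb _] /in_z[/= na' nb' _].
  rewrite /merge => -[eq_o]; subst o'.
  case: (eqVneq r q) => [eq_rq | neq_rq]; case: (eqVneq r' q) => [eq_rq' | neq_rq'].
  - by rewrite eq_rq eq_rq'.
  - move=> eq_pr'; subst r' r; case: (eqVneq o d) na' nb => [-> | neq_od]; first by rewrite eqxx.
    by rewrite (neq_negb neq_od) eqxx.
  - move=> eq_rp; subst r r'; case: (eqVneq o d) na nb' => [-> | neq_od]; first by rewrite eqxx.
    by rewrite (neq_negb neq_od) eqxx.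
  - by move=> ->.
move=> x /mapP[y y_in ->] /=; have [na nb xf] := in_z _ y_in.
have merge_in r : (~~ y.1, r) \in z -> (~~ y.1, merge p q r) \in relabel (merge p q) z.
  by move=> r_in; apply/mapP; exists (~~ y.1, r).
have [eq_yq | neq_yq] := eqVneq y.2 q.
  have def_y : y.1 = d.
    by apply: contraNeq nb => neq_yd; rewrite [y]surjective_pairing eq_yq (neq_negb neq_yd).
  have eq_m : merge p q y.2 = merge p q p by rewrite /merge eq_yq eqxx; case: ifP.
  rewrite eq_m; apply: merge_in.
  have := fz (d, p); rewrite !inE eqxx /= def_y => /(_ isT).
  have negF : (~~ d == d) = false by case: (d).
  rewrite !xpair_eqE negF !eqxx /=; case/orP=> // /eqP eq_pq.
  by case/eqP: na; rewrite [y]surjective_pairing def_y eq_yq eq_pq.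
case: xf => [[def_d eq_yp]|[[_ eq_yq]|]]; last exact: merge_in.
  have -> : merge p q y.2 = merge p q q by rewrite /merge eqxx (negPf neq_yq).
  apply: merge_in; have := fz (~~ d, q); rewrite !inE eqxx orbT /= negbK => /(_ isT).
  have negF : (d == ~~ d) = false by case: (d).
  rewrite !xpair_eqE negF !eqxx def_d /=; case/orP=> // /eqP eq_qp.
  by rewrite eq_yp eq_qp eqxx in neq_yq.
by rewrite eq_yq eqxx in neq_yq.
Qed.

Lemma paired_step n z e k m z' :
    strand_step n z e k m z' -> paired z -> below n z -> paired z' /\ below m z'.
Proof.
case=> {z e k m z'} [A C o|A C a b ab|A C a b x] pz lt_n.
- have lt_n1 y : y \in A ++ C -> y.2 < n by move=> /mem_unzip2/lt_n.
  split.
    apply: (@paired_perm ((o, n) :: (~~ o, n) :: A ++ C)).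
      by rewrite perm_sym perm_strands.
    case: pz => uz fz; split=> [|y] /=.
      rewrite !inE uz andbT negb_or xpair_eqE; case: (o) => /=.
        by apply/andP; split; apply/negP => /lt_n1; rewrite ltnn.
      by apply/andP; split; apply/negP => /lt_n1; rewrite ltnn.
    rewrite !inE => /or3P[/eqP->|/eqP->|/fz->] /=; rewrite ?orbT //.
      by rewrite eqxx orbT.
    by rewrite negbK eqxx.
  move=> p; rewrite (perm_mem (perm_map snd (perm_strands _ _ _ _))) /= !inE.
  by case/or3P=> [/eqP->|/eqP->|/lt_n/ltnW].
- have [pz' lt_n'] := (paired_perm (perm_strands A C a b) pz, below_perm (perm_strands A C a b) lt_n).
  split; first exact: paired_merge.
  apply: below_relabel => p p_in; rewrite /merge.
  by case: ifP => _; apply: lt_n'; rewrite /= !inE ?eqxx // p_in !orbT.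
- have zz' : perm_eq (A ++ a :: b :: C) (A ++ b :: a :: C).
    by rewrite perm_cat2l -[a :: _]/([:: a] ++ [:: b] ++ C) perm_catCA.
  by split; [apply: paired_perm zz' pz | apply: below_perm zz' lt_n].
Qed.

(** As long as strands remain, the next slice closes a circle or leaves strands, and none remain at
    the end. *)
Lemma ncircles_gt0 n z w : paired z -> below n z -> z <> [::] ->
  run (unzip1 z) w = Some [::] -> 0 < ncircles n z w.
Proof.
elim: w n z => [|e w IHw] n z pz lt_n z_neq0; first by case: z z_neq0 {pz lt_n}.
case/(run_step n)=> k [m [z' [step_e run_w]]].
rewrite (ncircles_step _ step_e).
have [pz' lt_m] := paired_step step_e pz lt_n.
suff [k_gt0 | z'_neq0] : 0 < k \/ z' <> [::]; first by rewrite addn_gt0 k_gt0.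
  by rewrite addn_gt0 IHw // orbT.
case: step_e pz {z_neq0 run_w pz' lt_n lt_m} => [A C o|A C a b ab|A C a b x] pz; try by right; case: (A).
have [|neq_ab] := eqVneq a.2 b.2; [by left | right].
(* A maximum joining two different arcs leaves their other ends among the remaining strands. *)
case EAC: (A ++ C) => // _; have [_ fz] := paired_perm (perm_strands A C a b) pz.
have := fz a; rewrite EAC mem_head => /(_ isT); rewrite !inE => /orP[] /eqP.
  by rewrite [in RHS](surjective_pairing a) => -[]; case: (a.1).
by move=> def_b; rewrite -def_b eqxx in neq_ab.
Qed.

Lemma ncircles_prefix n z u s : paired z -> below n z -> run (unzip1 z) u = Some s ->
  exists k m z', [/\ paired z', below m z', unzip1 z' = s &
    forall v, ncircles n z (u ++ v) = k + ncircles m z' v].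
Proof.
elim: u n z => [|e u IHu] n z pz lt_n; first by case=> <-; exists 0, n, z.
case/(run_step n)=> k [m [z' [step_e run_u]]].
have [pz' lt_m] := paired_step step_e pz lt_n.
have [k' [m' [z'' [pz'' lt_m' def_s eq_v]]]] := IHu m z' pz' lt_m run_u.
exists (k + k'), m', z''; split=> // v.
by rewrite cat_cons (ncircles_step _ step_e) eq_v addnA.
Qed.

(** The order of the legs only decides which of the two labels survives the merge, and the results
    differ by an injective renaming. *)
Lemma ncircles_cap_sym n A C a b w t : a.1 != b.1 ->
    below n (A ++ a :: b :: C) -> run (unzip1 (A ++ C)) w = Some t ->
  ncircles n (A ++ a :: b :: C) ((Cap, size A) :: w) =
  ncircles n (A ++ b :: a :: C) ((Cap, size A) :: w).
Proof.
move=> ab lt_n run_w; have ba : b.1 != a.1 by rewrite eq_sym.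
rewrite (ncircles_step _ (StepCap n A C ab)) (ncircles_step _ (StepCap n A C ba)).
rewrite eq_sym; congr (_ + _); have [-> // | neq_ba] := eqVneq b.2 a.2.
have lt_n' := below_perm (perm_strands A C a b) lt_n.
have lt_f p q r : p \in unzip2 [:: a, b & A ++ C] -> r \in unzip2 (A ++ C) -> merge p q r < n.
  by move=> p_in r_in; rewrite /merge; case: ifP => _; apply: lt_n' => //; rewrite /= !inE r_in !orbT.
have a_in : a.2 \in unzip2 [:: a, b & A ++ C] by rewrite mem_head.
have b_in : b.2 \in unzip2 [:: a, b & A ++ C] by rewrite inE mem_head orbT.
have E : relabel (merge b.2 a.2) (A ++ C) =
    relabel (merge b.2 a.2) (relabel (merge a.2 b.2) (A ++ C)).
  rewrite relabel_comp; apply/eq_in_map => y _; congr (_, _) => /=.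
  by rewrite /merge; case: (eqVneq y.2 b.2) => [->|]; rewrite ?eqxx ?(negPf neq_ba).
rewrite [in RHS]E; apply/esym; apply: (@ncircles_relabel _ n n _ _ t).
- have neq_b p : p \in unzip2 (relabel (merge a.2 b.2) (A ++ C)) -> p != b.2.
    rewrite unzip2_relabel => /mapP[q _ ->]; rewrite /merge.
    by case: (eqVneq q b.2) => // _; rewrite eq_sym.
  move=> p q /neq_b pb /neq_b qb; rewrite /merge.
  case: (eqVneq p a.2) => [->|_]; case: (eqVneq q a.2) => [->|_] //.
    by move=> eq_bq; rewrite eq_bq eqxx in qb.
  by move=> eq_pb; rewrite eq_pb eqxx in pb.
- by apply: below_relabel => p; apply: lt_f.
- by rewrite -E; apply: below_relabel => p; apply: lt_f.
- by rewrite unzip1_relabel.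
Qed.

(** * Exchanging the partners of two strands *)

Definition transpose (p q r : nat) := if r == p then q else if r == q then p else r.

(** Acting on the strands of direction [d] alone, it exchanges the partners of two equally oriented
    strands. *)
Definition swap_labels (d : bool) (p q : nat) z : strands :=
  [seq (x.1, if x.1 == d then transpose p q x.2 else x.2) | x <- z].

Lemma transposeC p q : transpose p q =1 transpose q p.
Proof. by move=> r; rewrite /transpose; case: eqP => [->|_] //; case: eqP. Qed.

Lemma swap_labelsC d p q z : swap_labels d p q z = swap_labels d q p z.
Proof. by apply: eq_map => x; rewrite transposeC. Qed.

Lemma unzip1_swap d p q z : unzip1 (swap_labels d p q z) = unzip1 z.
Proof. by rewrite /unzip1 -map_comp. Qed.

Lemma transpose_mem p q r (s : seq nat) : p \in s -> q \in s -> r \in s -> transpose p q r \in s.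
Proof. by move=> ps qs rs; rewrite /transpose; do 2!case: ifP => // _. Qed.

Lemma below_swap n d p q z : p \in unzip2 z -> q \in unzip2 z -> below n z ->
  below n (swap_labels d p q z).
Proof.
move=> pz qz lt_n r; rewrite /unzip2 -map_comp => /mapP[x /mem_unzip2 x_in ->] /=.
by apply: lt_n; case: ifP => // _; apply: transpose_mem.
Qed.

Lemma paired_mem z d p : paired z -> p \in unzip2 z -> (d, p) \in z.
Proof.
case=> _ fz /mapP[[e r] x_in ->] /=; have := fz _ x_in.
by case: (eqVneq d e) => [->|/neq_negb->].
Qed.

(** At a maximum, either the exchange survives above it, with labels [p'] and [q'], or it is used
    up: the same strands remain, and the maximum closes a circle in exactly one of the two
    situations. *)
Lemma swap_cap d p q r s R :
    paired ((d, r) :: (~~ d, s) :: R) -> p <> q ->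
    p \in unzip2 [:: (d, r), (~~ d, s) & R] -> q \in unzip2 [:: (d, r), (~~ d, s) & R] ->
  let R1 := relabel (merge r s) R in
  let R2 := relabel (merge (transpose p q r) s) (swap_labels d p q R) in
  (exists p' q', [/\ p' <> q', p' \in unzip2 R1, q' \in unzip2 R1,
      R2 = swap_labels d p' q' R1 & (r == s) = (transpose p q r == s)]) \/
  (R1 = R2 /\ (r == s) != (transpose p q r == s)).
Proof.
move=> pz; have memR x : x \in R -> if x.1 == d then x.2 <> r else x.2 <> s.
  case: pz => /and3P[]; rewrite inE negb_or => /andP[_ a_notin] b_notin _ _ x_in.
  case: ifP => [/eqP|/negbT/neq_negb] def_x; apply/eqP.
    by apply: contraNneq a_notin => <-; rewrite -def_x -surjective_pairing.
  by apply: contraNneq b_notin => <-; rewrite -def_x -surjective_pairing.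
have in_R t : t \in unzip2 [:: (d, r), (~~ d, s) & R] -> t <> r -> (d, t) \in R.
  move=> /(paired_mem d pz); rewrite !inE !xpair_eqE eqxx => + /eqP neq_tr.
  by rewrite (negPf neq_tr); case: (d).
have in_R1 t : (d, t) \in R -> merge r s t \in unzip2 (relabel (merge r s) R).
  by move=> /mem_unzip2 /= t_in; rewrite unzip2_relabel map_f.
(* By symmetry of the transposition, [r] may be assumed different from [q]. *)
wlog neq_rq : p q / r <> q => [main neq_pq p_in q_in|neq_pq p_in q_in R1 R2].
  have [r_q | neq_rq] := eqVneq r q; last by apply: main => //; apply/eqP.
  have trE : transpose p q r = transpose q p r by rewrite transposeC.
  by rewrite trE swap_labelsC; apply: main => //; [rewrite r_q; apply: nesym | apply: nesym].
have [r_p | /eqP neq_rp] := eqVneq r p; last first.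
  left; exists (merge r s p), (merge r s q).
  have trE : transpose p q r = r by rewrite /transpose; do 2!case: eqP => //.
  split; [|by apply/in_R1/in_R/nesym|by apply/in_R1/in_R/nesym| |by rewrite trE].
    by rewrite /merge; do 2!case: eqP; congruence.
  rewrite /R2 /R1 trE /relabel /swap_labels -!map_comp; apply/eq_in_map => x /memR /=.
  case: ifP => _ x_r; congr (_, _); rewrite /merge /transpose.
  by do !case: eqP => //=; congruence.
have trE : transpose p q r = q by rewrite /transpose r_p eqxx.
(* Now [r] is [p], and the exchange gives the capped strand the label [q]. It is used up precisely
   when the other leg has label [p] or [q]. *)
have [s_p | /eqP neq_sp] := eqVneq s p; [right | have [s_q | /eqP neq_sq] := eqVneq s q; [right|left]].
- rewrite trE; split; last by rewrite r_p s_p eqxx; case: (q =P p) => // eq_qp; case: neq_pq; rewrite eq_qp.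
  rewrite /R2 /R1 trE /relabel /swap_labels -!map_comp; apply/eq_in_map => x /memR /=.
  by case: ifP => _ x_r; congr (_, _); rewrite /merge /transpose; do !case: eqP => //=; congruence.
- rewrite trE; split; last by rewrite r_p s_q eqxx; case: (p =P q) => // eq_pq; case: neq_pq.
  rewrite /R2 /R1 trE /relabel /swap_labels -!map_comp; apply/eq_in_map => x /memR /=.
  by case: ifP => _ x_r; congr (_, _); rewrite /merge /transpose; do !case: eqP => //=; congruence.
exists p, q; split=> //.
- have -> : p = merge r s s by rewrite /merge eqxx.
  by apply/in_R1/in_R; rewrite ?r_p // /= !inE eqxx orbT.
- have -> : q = merge r s q by rewrite /merge; case: eqP => // /esym/neq_sq.
  by apply/in_R1/in_R => //; apply: nesym.
- rewrite /R2 /R1 trE /relabel /swap_labels -!map_comp; apply/eq_in_map => x /memR /=.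
  case: ifP => _ x_r; congr (_, _); rewrite /merge /transpose;
    do !case: eqP => //=; congruence.
- rewrite trE r_p; move/eqP/negPf: neq_sp => neq_sp; move/eqP/negPf: neq_sq => neq_sq.
  by rewrite ![_ == s]eq_sym neq_sp neq_sq.
Qed.

Definition differ_by_one (i j : nat) := i = j.+1 \/ j = i.+1.

Lemma ncircles_swap_cap n A C a b w d p q :
    (forall p' q' z, paired z -> below n z -> p' <> q' ->
       p' \in unzip2 z -> q' \in unzip2 z -> run (unzip1 z) w = Some [::] ->
     differ_by_one (ncircles n z w) (ncircles n (swap_labels d p' q' z) w)) ->
    a.1 = d -> b.1 = ~~ d ->
    paired (A ++ a :: b :: C) -> below n (A ++ a :: b :: C) -> p <> q ->
    p \in unzip2 (A ++ a :: b :: C) -> q \in unzip2 (A ++ a :: b :: C) ->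
    run (unzip1 (A ++ C)) w = Some [::] ->
  differ_by_one (ncircles n (A ++ a :: b :: C) ((Cap, size A) :: w))
    (ncircles n (swap_labels d p q (A ++ a :: b :: C)) ((Cap, size A) :: w)).
Proof.
case: a b => [_ r] [_ s] IH /= -> ->; set z := A ++ _ => pz lt_n neq_pq p_in q_in run_w.
have dNd : d != ~~ d by case: (d).
have step_z := StepCap n A C (a := (d, r)) (b := (~~ d, s)) dNd.
have [pz' lt_n'] := paired_step step_z pz lt_n.
have perm_z := perm_strands A C (d, r) (~~ d, s).
have mem_z t : t \in unzip2 z -> t \in unzip2 [:: (d, r), (~~ d, s) & A ++ C].
  by rewrite (perm_mem (perm_map snd perm_z)).
rewrite (ncircles_step _ step_z).
have -> : swap_labels d p q z = swap_labels d p q A ++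
    (d, transpose p q r) :: (~~ d, s) :: swap_labels d p q C.
  by rewrite /swap_labels map_cat /= eqxx eq_sym (negPf dNd).
have step_z' := StepCap n (swap_labels d p q A) (swap_labels d p q C)
    (a := (d, transpose p q r)) (b := (~~ d, s)) dNd.
have := ncircles_step w step_z'; rewrite size_map /= => ->.
have -> : swap_labels d p q A ++ swap_labels d p q C = swap_labels d p q (A ++ C).
  by rewrite /swap_labels map_cat.
have [[p' [q' [neq_pq' p'_in q'_in -> ->]]] | [<- neq_closed]] :=
  swap_cap (paired_perm perm_z pz) neq_pq (mem_z _ p_in) (mem_z _ q_in).
  have := IH p' q' _ pz' lt_n' neq_pq' p'_in q'_in; rewrite unzip1_relabel => /(_ run_w).
  by case=> /= ->; [left | right]; rewrite addnS.
move: neq_closed; case: (r == s); case: (_ == s) => // _; [by left | by right].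
Qed.

(** The exchange is carried upwards without effect on the count until a maximum uses it up, changing
    the count by one. This must happen, since no strand remains at the top. *)
Lemma ncircles_swap n z w d p q :
    paired z -> below n z -> p <> q -> p \in unzip2 z -> q \in unzip2 z ->
    run (unzip1 z) w = Some [::] ->
  differ_by_one (ncircles n z w) (ncircles n (swap_labels d p q z) w).
Proof.
elim: w n p q z => [|e w IHw] n p q z pz lt_n neq_pq p_in q_in; first by case: z p_in {pz lt_n q_in}.
case/(run_step n)=> k [m [z' [step_e run_w]]].
have [pz' lt_m] := paired_step step_e pz lt_n.
have swap_cat A B : swap_labels d p q (A ++ B) = swap_labels d p q A ++ swap_labels d p q B.
  by rewrite /swap_labels map_cat.
case: step_e pz lt_n p_in q_in run_w pz' lt_m => {z e k m z'} [A C o|A C a b ab|A C a b x]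
  pz lt_n p_in q_in run_w pz' lt_m.
- have sAC t : t \in unzip2 (A ++ C) -> t \in unzip2 (A ++ (o, n) :: (~~ o, n) :: C).
    rewrite /unzip2 !map_cat !mem_cat /= !inE.
    by case/orP=> ->; rewrite ?orbT.
  have neq_n t : t \in unzip2 (A ++ C) -> (n == t) = false.
    by move/lt_n; rewrite ltn_neqAle eq_sym => /andP[/negPf].
  have := IHw n.+1 p q _ pz' lt_m neq_pq (sAC _ p_in) (sAC _ q_in) run_w.
  rewrite (ncircles_step _ (StepCup n A C o)) !swap_cat /=.
  rewrite /transpose !(neq_n _ p_in) !(neq_n _ q_in) !if_same.
  have := ncircles_step w (StepCup n (swap_labels d p q A) (swap_labels d p q C) o).
  by rewrite size_map => -> /=.
- rewrite unzip1_relabel in run_w; have [def_a | neq_ad] := eqVneq a.1 d.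
    apply: ncircles_swap_cap => //; first by move=> *; apply: IHw.
    by apply: neq_negb; rewrite -def_a eq_sym.
  (* The leg of direction [d] is on the right; the maximum is turned round to put it first. *)
  have def_b : b.1 = d by move: ab neq_ad; case: (a.1) (b.1) (d) => -[] [].
  have perm_ab : perm_eq (A ++ a :: b :: C) (A ++ b :: a :: C).
    by rewrite perm_cat2l -[a :: _]/([:: a] ++ [:: b] ++ C) perm_catCA.
  have mem_ab := perm_mem (perm_map snd perm_ab).
  rewrite (ncircles_cap_sym ab lt_n run_w).
  pose sw x : bool * nat := (x.1, if x.1 == d then transpose p q x.2 else x.2).
  have swE x y : swap_labels d p q (A ++ x :: y :: C) =
      swap_labels d p q A ++ sw x :: sw y :: swap_labels d p q C.
    by rewrite swap_cat.
  have lt_n' := @below_swap n d p q _ p_in q_in lt_n; rewrite swE in lt_n'.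
  have run_w' : run (unzip1 (swap_labels d p q A ++ swap_labels d p q C)) w = Some [::].
    by rewrite -swap_cat unzip1_swap.
  have := ncircles_cap_sym (a := sw a) (b := sw b) ab lt_n' run_w'.
  rewrite size_map swE => ->; rewrite -swE.
  apply: ncircles_swap_cap => //; first by move=> *; apply: IHw.
  + exact: neq_negb.
  + exact: paired_perm perm_ab pz.
  + exact: below_perm perm_ab lt_n.
  + by rewrite -mem_ab.
  + by rewrite -mem_ab.
- have perm_AC : unzip2 (A ++ b :: a :: C) =i unzip2 (A ++ a :: b :: C).
    by move=> t; rewrite /unzip2 !map_cat !mem_cat /= !inE; congr (_ || _); rewrite orbCA.
  rewrite (ncircles_step _ (StepCross n A C a b x)) -!perm_AC in p_in q_in *.
  have := IHw n p q _ pz' lt_m neq_pq p_in q_in run_w.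
  rewrite !swap_cat /=.
  have := ncircles_step w (StepCross n (swap_labels d p q A) (swap_labels d p q C)
    (a.1, if a.1 == d then transpose p q a.2 else a.2)
    (b.1, if b.1 == d then transpose p q b.2 else b.2) x).
  by rewrite size_map => -> /=.
Qed.

(** The crossed and the smoothed strands are shown to differ by one exchange of partners, except
    when a smoothing closes a circle at once. *)
Lemma ncircles_smoothing n (A C : strands) (a b : bool * nat) (v : word bool) :
    paired (A ++ a :: b :: C) -> below n (A ++ a :: b :: C) ->
    run (unzip1 (A ++ b :: a :: C)) v = Some [::] ->
  differ_by_one (ncircles n (A ++ b :: a :: C) v)
    (ncircles n (A ++ a :: b :: C) (oriented_smoothing a.1 b.1 (size A) ++ v)).
Proof.
case: a b => [d r] [e s] /= pz lt_n run_v.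
have pz2 := paired_perm (perm_strands A C _ _) pz.
have lt_n2 := below_perm (perm_strands A C _ _) lt_n.
have perm_z1 : perm_eq (A ++ (d, r) :: (e, s) :: C) (A ++ (e, s) :: (d, r) :: C).
  by rewrite perm_cat2l -[_ :: _ :: C]/([:: (d, r)] ++ [:: (e, s)] ++ C) perm_catCA.
have pz1 := paired_perm perm_z1 pz; have lt_n1 := below_perm perm_z1 lt_n.
have r_lt : r < n by apply: lt_n2; rewrite /= mem_head.
have s_lt : s < n by apply: lt_n2; rewrite /= !inE eqxx orbT.
have lt_AC x : x \in A ++ C -> x.2 < n.
  by move=> x_in; apply: lt_n2; apply: mem_unzip2; rewrite !inE x_in !orbT.
have neq_AC x : x \in A ++ C -> x <> (d, r) /\ x <> (e, s).
  case: (pz2) => /and3P[]; rewrite inE negb_or => /andP[_ dr] es _ _ x_in.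
  by split=> def_x; rewrite -def_x x_in in dr es.
rewrite /oriented_smoothing; case: (eqVneq d e) => [eq_de | neq_de].
  subst e; have neq_rs : s <> r.
    by case: pz2 => /andP[]; rewrite inE negb_or => /andP[/eqP] + _ _ _ eq_rs; rewrite eq_rs.
  have -> : A ++ [:: (d, r), (d, s) & C] = swap_labels d s r (A ++ [:: (d, s), (d, r) & C]).
    have sw_id B : {subset B <= A ++ C} -> swap_labels d s r B = B.
      move=> sB; rewrite -[RHS]map_id; apply/eq_in_map => -[o t] /sB/neq_AC[] /=.
      case: eqP => [-> | //] dr ds; congr (_, _); rewrite /transpose.
      by do !case: eqP => //; congruence.
    rewrite /swap_labels map_cat /= -!/(swap_labels _ _ _ _) !sw_id.
    - by rewrite eqxx /transpose !eqxx; case: eqP => // eq_rs; case: neq_rs.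
    - by move=> x; rewrite mem_cat orbC => ->.
    - by move=> x; rewrite mem_cat => ->.
  by apply: ncircles_swap => //; apply: mem_unzip2 (_ : (d, _) \in _);
    rewrite mem_cat !inE eqxx ?orbT.
have def_e : e = ~~ d by apply: neq_negb; rewrite eq_sym.
subst e; rewrite /= (ncircles_step _ (StepCap n A C (a := (d, r)) (b := (~~ d, s)) neq_de)) /=.
pose A1 := relabel (merge r s) A; pose C1 := relabel (merge r s) C.
have -> : relabel (merge r s) (A ++ C) = A1 ++ C1 by rewrite /relabel map_cat.
have := ncircles_step v (StepCup n A1 C1 (~~ d)); rewrite size_map => ->.
rewrite negbK add0n; set zc := A1 ++ _.
have step_z := StepCap n A C (a := (d, r)) (b := (~~ d, s)) neq_de.
have [pAC ltAC] := paired_step step_z pz lt_n.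
have rel_z1 B (g : nat -> nat) : relabel g (A ++ B ++ C) = relabel g A ++ relabel g B ++ relabel g C.
  by rewrite /relabel !map_cat.
(* On the crossed side [s] is renamed to [n], the label of the new minimum on the smoothed side. *)
have eqz1 : ncircles n (A ++ [:: (~~ d, s), (d, r) & C]) v =
    ncircles n.+1 (relabel (merge n s) (A ++ [:: (~~ d, s), (d, r) & C])) v.
  apply/esym; apply: ncircles_relabel run_v => //.
    move=> p q /lt_n1 p_n /lt_n1 q_n; rewrite /merge; do 2!case: eqP => [->|_] //.
      by move=> eq_nq; rewrite eq_nq ltnn in q_n.
    by move=> eq_pn; rewrite eq_pn ltnn in p_n.
  by apply: below_relabel => p /lt_n1 p_n; rewrite /merge; case: ifP => // _; apply: ltnW.
rewrite {}eqz1 (rel_z1 [:: (~~ d, s); (d, r)]) /=.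
(* If the two strands bound one arc, the maximum closes it and the minimum starts a copy in its
   place: one circle more, and the rest agrees. *)
have [eq_rs | neq_rs] := eqVneq r s.
  subst s; right; rewrite add1n; congr (ncircles _ _ _).+1.
  have mE : merge n r r = n by rewrite /merge eqxx.
  have rel_id B : {subset B <= A ++ C} -> relabel (merge r r) B = relabel (merge n r) B.
    move=> sB; apply/eq_in_map => -[o t] /sB/neq_AC[] /=.
    by rewrite /merge; case: eqP => // ->; case: (o) (d) => -[].
  rewrite /zc mE -!rel_id // => x; last by rewrite mem_cat => ->.
  by rewrite mem_cat orbC => ->.
rewrite add0n.
(* Otherwise the arcs [r] and [s] are joined by the maximum, and exchanging [n] with [r] in
   direction [d] recovers the crossed strands. *)
have -> : relabel (merge n s) A ++ [:: (~~ d, merge n s s), (d, merge n s r) & relabel (merge n s) C] =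
    swap_labels d n r zc.
  have sw_rel B : {subset B <= A ++ C} ->
      swap_labels d n r (relabel (merge r s) B) = relabel (merge n s) B.
    move=> sB; rewrite /swap_labels /relabel -map_comp; apply/eq_in_map => -[o t] /sB.
    move=> x_in; have [/= dr ds] := neq_AC _ x_in; have /= t_n := lt_AC _ x_in.
    congr (_, _); move: dr ds t_n; rewrite /merge /transpose.
    case: eqP => [-> dr _ t_n | /eqP/neq_negb-> _ ds _]; last by case: eqP => // t_s; rewrite t_s in ds.
    have neq_tn : t <> n by move=> eq_tn; rewrite eq_tn ltnn in t_n.
    have neq_tr : t <> r by move=> eq_tr; rewrite eq_tr in dr.
    have neq_rn : r <> n by move=> eq_rn; rewrite eq_rn ltnn in r_lt.
    by do !case: eqP => //=; congruence.
  have mE : merge n s s = n by rewrite /merge eqxx.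
  have mE' : merge n s r = r by rewrite /merge (negPf neq_rs).
  rewrite /zc /swap_labels map_cat /= -!/(swap_labels _ _ _ _) mE mE'.
  rewrite /A1 /C1 !sw_rel => [|x|x].
  - by rewrite eqxx eq_sym (negPf neq_de) /transpose eqxx.
  - by rewrite mem_cat orbC => ->.
  - by rewrite mem_cat => ->.
have [pzc lt_zc] := paired_step (StepCup n A1 C1 (~~ d))
  (eq_ind _ paired pAC _ (map_cat _ _ _)) (eq_ind _ (below n) ltAC _ (map_cat _ _ _)).
rewrite negbK -/zc in pzc lt_zc.
have r_in : (~~ d, r) \in A ++ C.
  have := pz2.2 (d, r); rewrite mem_head => /(_ isT).
  have ndF : (~~ d == d) = false by case: (d).
  by rewrite !inE !xpair_eqE ndF (negPf neq_rs) andbF.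
have swap_dbo := @ncircles_swap n.+1 zc v d n r pzc lt_zc.
suff [] : differ_by_one (ncircles n.+1 zc v) (ncircles n.+1 (swap_labels d n r zc) v).
- by right.
- by left.
apply: swap_dbo.
- by move=> eq_nr; rewrite -eq_nr ltnn in r_lt.
- by apply: (mem_unzip2 (x := (d, n))); rewrite mem_cat !inE eqxx !orbT.
- have := map_f (fun x => (x.1, merge r s x.2)) r_in; rewrite map_cat /=.
  rewrite {1}/merge (negPf neq_rs) => /mem_unzip2 /=.
  rewrite /zc /A1 /C1 /unzip2 !map_cat !mem_cat /= !inE.
  by case/orP=> ->; rewrite ?orbT.
- rewrite -run_v; congr run; rewrite /zc /A1 /C1 /unzip1 !map_cat /= -!/(unzip1 _).
  by rewrite !unzip1_relabel.
Qed.

(** * The invariant *)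

Lemma closed_circles_shadow n s (w : word bool) :
  closed_circles n s (map shadow_slice w) = closed_circles n s w.
Proof.
elim: w n s => [|[[o||[x|]] i] w IHw] n s //; first exact: IHw.
- by congr (_ + _); apply: IHw.
- exact: IHw.
- exact: IHw.
Qed.

Lemma paired_nil : paired [::]. Proof. by []. Qed.

Lemma below_nil n : below n [::]. Proof. by []. Qed.

Lemma ncomponents_smooth (D : diagram bool) c :
  ncomponents D = 1 -> is_real (word_of D) c -> ncomponents (smooth D c) = 2.
Proof.
(* The knot forces no circle closed below and one above; a positive count differing from one by one
   is two. *)
have arith i j k : 1 = i + j -> 0 < j -> 0 < k -> differ_by_one j k -> i + k = 2.
  case: j => [|j] //; rewrite addnS => -[/esym/eqP]; rewrite addn_eq0.
  by case/andP=> /eqP-> /eqP-> _; case: k => [|k] // _ [] [] // ->.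
move: (eqP (smooth_subproof D c)); rewrite /ncomponents /is_real.
case: D => w wP /= + circ_w; rewrite /smooth_word /strands_at; case Ec: (nth _ w c) => [[o||[x|]] i] // + _.
have lt_cw : c < size w.
  by rewrite ltnNge; apply/negP => le_wc; rewrite nth_default in Ec.
have def_w : w = take c w ++ (Cross (Real x), i) :: drop c.+1 w.
  by rewrite -Ec -drop_nth // cat_take_drop.
move: circ_w (eqP wP); rewrite {1 2}def_w.
move: (take c w) (drop c.+1 w) => u v circ_w + run_sm; move: run_sm.
rewrite !run_cat; case run_u: (run _ u) => [s|] //.
set sm := (if _ then _ else _); rewrite -[obind _ _ in X in X -> _]/(run s (sm ++ v)) => run_sm.
rewrite -[obind _ _]/(run s ((Cross (Real x), i) :: v)) run_cons.
case pass_x: (pass s _) => [s1|] // run_v.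
have [k [m [z [pz lt_m def_s circ_u]]]] := ncircles_prefix paired_nil (below_nil 0) run_u.
have [k1 [m1 [z1 [step_x def_s1]]]] : exists k1 m1 z1,
    strand_step m z (Cross (Real x), i) k1 m1 z1 /\ unzip1 z1 = s1.
  by apply: pass_step; rewrite def_s.
have circ_x := circ_u ((Cross (Real x), i) :: v).
rewrite (ncircles_step _ step_x) -[LHS]/(closed_circles 0 [::] _) circ_w in circ_x.
have [pz1 lt_m1] := paired_step step_x pz lt_m.
rewrite -[LHS]/(ncircles 0 [::] _).
have [A [C [a [b [def_z def_z1 def_i [k1_0 m1_m]]]]]] : exists A C a b,
    [/\ z = A ++ a :: b :: C, z1 = A ++ b :: a :: C, i = size A & k1 = 0 /\ m1 = m].
  by inversion step_x as [| |A C a b]; exists A, C, a, b.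
subst z z1 i k1 m1; rewrite add0n in circ_x.
have run_v' : run (unzip1 (A ++ b :: a :: C)) v = Some [::] by rewrite def_s1.
have [nth_a nth_b] : nth true s (size A) = a.1 /\ nth true s (size A).+1 = b.1.
  rewrite -def_s /unzip1 map_cat !nth_cat size_map ltnn subnn /=.
  by rewrite ltnNge leqnSn /= subSnn.
rewrite /sm nth_a nth_b circ_u.
have z1_neq0 : A ++ b :: a :: C <> [::] by case: (A).
have z_neq0 : A ++ a :: b :: C <> [::] by case: (A).
have pos1 := ncircles_gt0 pz1 lt_m1 z1_neq0 run_v'.
have by_one := ncircles_smoothing pz lt_m run_v'.
have pos : 0 < ncircles m (A ++ a :: b :: C) (oriented_smoothing a.1 b.1 (size A) ++ v).
  apply: ncircles_gt0 => //; rewrite def_s.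
  by rewrite /sm nth_a nth_b in run_sm.
exact: arith circ_x pos1 pos by_one.
Qed.

Lemma ncomponents_add_circle (D : diagram bool) :
  ncomponents (add_circle (shadow D)) = (ncomponents D).+1.
Proof.
rewrite /ncomponents /=.
have -> : [seq shadow_slice e | e <- word_of D] ++ [:: (Cup true, 0); (Cap, 0)] =
    [seq shadow_slice e | e <- word_of D ++ circle true 0] by rewrite map_cat.
rewrite closed_circles_shadow; case: D => w /= /eqP run_w.
have [k [m [z [_ _ def_z circ_w]]]] := ncircles_prefix paired_nil (below_nil 0) run_w.
have {def_z} z0 : z = [::] by case: z def_z {circ_w}.
have := circ_w [::]; have := circ_w (circle true 0); rewrite z0 cats0.
by rewrite /ncircles /= !addn0 => eq1 eq2; rewrite eq1 eq2 eqxx addn1.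
Qed.

(** * Values in the free module, and descent to knots *)

Section Linking.
Local Open Scope ring_scope.

Lemma calL_crossing_sum (D : diagram bool) : calL D = crossing_sum (word_of D).
Proof.
have run_D : run [::] (word_of D) = Some [::] by case: D => w /= /eqP.
have gen_smooth c : (<< flat_link_of (shadow (smooth D c)) >> : M) =
    flat_gen (smooth_word (word_of D) c).
  by rewrite /flat_gen -[smooth_word _ _]/(word_of (smooth D c)) flat_class_word.
have gen_circle : (<< flat_link_of (add_circle (shadow D)) >> : M) =
    flat_gen (word_of D ++ circle true 0).
  have runU : run [::] (word_of D ++ circle true 0) == Some [::] by rewrite run_cat run_D.
  rewrite /flat_gen -[_ ++ _]/(word_of (Diagram runU)) flat_class_word.
  by congr (<< flat_link_of _ >>); apply: val_inj; rewrite /= map_cat.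
have run0 : run [::] ([::] : word bool) = Some [::] by [].
rewrite /calL /writhe gen_circle; under eq_bigr => c _ do rewrite gen_smooth.
rewrite (sum_smoothings (fun e y => e *: flat_gen y : M) run0 run_D).
rewrite (sum_smoothings (fun e y => e : int) run0 run_D).
rewrite scaler_suml -sumrB; apply: eq_bigr => x _.
by rewrite scalerBr.
Qed.

Lemma calL_virtual_step (D D' : diagram bool) : virtual_step D D' -> calL D = calL D'.
Proof.
case=> u [l [r [v [def_D def_D' mlr]]]]; rewrite !calL_crossing_sum def_D def_D'.
apply: crossing_sum_move => //.
  by rewrite -def_D; case: (D) => w /= /eqP.
by rewrite -def_D'; case: (D') => w /= /eqP.
Qed.

Lemma calL_knot_equiv (D D' : knot_diagram) : knot_equiv D D' -> calL (val D) = calL (val D').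
Proof.
move=> /asboolP; elim=> [E E' | E | E E' _ -> | E E' E'' _ -> _ ->] //.
exact: calL_virtual_step.
Qed.

Lemma fglift_M2B (x y : M2) : M2_in_M (x - y) = M2_in_M x - M2_in_M y.
Proof. exact: lift_is_additive. Qed.

Lemma calL_in_M2 (D : knot_diagram) : exists m : M2, M2_in_M m = calL (val D).
Proof.
have knot_D : ncomponents (val D) = 1%N by apply/eqP/(valP D).
pose in_M2 (x : M) := exists m : M2, M2_in_M m = x.
have in_M2B x y : in_M2 x -> in_M2 y -> in_M2 (x - y).
  by case=> m <- [m' <-]; exists (m - m'); rewrite fglift_M2B.
have in_M20 : in_M2 0 by exists (0 - 0); rewrite fglift_M2B subrr.
have in_M2D x y : in_M2 x -> in_M2 y -> in_M2 (x + y).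
  by move=> mx my; rewrite -[y]opprK -[- y]sub0r; apply: (in_M2B) => //; apply: (in_M2B).
have in_M2Z e (E : diagram unit) : ncomponents E = 2 ->
    in_M2 (e *: (<< flat_link_of E >> : M)).
  move=> E2; have E2P : two_components (flat_link_of E) by apply/asboolP; exists E.
  exists (<< e *g (Sub (flat_link_of E) E2P : flat_link2) >>).
  by rewrite /M2_in_M liftU SubK.
apply: in_M2B; last first.
  by apply: in_M2Z; rewrite ncomponents_add_circle knot_D.
apply: big_ind => // c real_c; apply: in_M2Z.
rewrite /ncomponents closed_circles_shadow; exact: ncomponents_smooth.
Qed.

End Linking.

Theorem theorem3p10 :
  exists L : virtual_knot -> M2,
    forall D : knot_diagram, M2_in_M (L (knot_of D)) = calL (proj1_sig D).
Proof.
(* The value is chosen at the canonical representative of the class; invariance in [M] carries it to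
   every other diagram. *)
exists (fun k => sval (cid (calL_in_M2 (repr k)))) => D.
case: cid => m /= ->; apply: calL_knot_equiv.
by apply/eqmodP; rewrite reprK.
Qed.
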